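(* Let $G$ be an infinite, finitely generated group, generated as a semigroup by the finite symmetric set $S\subseteq G\setminus\{e\}$, with edge lengths $l$, such that there is no symmetric set $\{s,s'\}\subseteq S$ with $G=\langle s,s'\rangle$. Let $(Z_n)_{n\in\mathbb{N}_0}=((\eta_n,X_n))_{n\in\mathbb{N}_0}$ be a lamplighter random walk on $\mathbb{Z}_2\wr G$ as described in the context, whose projection $(X_n)_{n\in\mathbb{N}_0}$ onto $G$ is transient. Then $$\ell\ \ge\ \ell_{\mathrm{TS}}\ >\ \ell_0 .$$
   Context: $e$ is the identity of $G$. Each $s\in S$ has a length $l(s)=l(s^{-1})>0$. The metric on $G$ is $d(x,y)=\min\{\sum_{i=1}^n l(s_i) : s_1,\dots,s_n\in S,\ y=xs_1\cdots s_n\}$. A path in $G$ is a finite sequence $[x_0,\dots,x_n]$ with $x_{i-1}^{-1}x_i\in S$; its length is $\sum_i l(x_{i-1}^{-1}x_i)$. A subset of $G$ is symmetric if it is closed under inverses. $\mathbb{Z}_2=\mathbb{Z}/2\mathbb{Z}$; $\mathcal{N}$ is the set of finitely supported $\eta:G\to\mathbb{Z}_2$; $\mathbf{0}$ is the zero configuration. $\mathcal{L}=\mathbb{Z}_2\wr G$ is $\mathcal{N}\times G$ with product $(\eta_1,x)(\eta_2,y)=(\eta_1\oplus x\eta_2,xy)$, where $(x\eta)(w)=\eta(x^{-1}w)$ and $\oplus$ is componentwise addition mod 2. $d_{\mathrm{TS}}(\eta,x)$ is the minimal length of a path in $G$ from $e$ to $x$ that visits every $y\in\mathrm{supp}(\eta)$.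 With a fixed constant $c_{\mathcal{L}}\ge 0$, $\ell(\eta,x):=d_{\mathrm{TS}}(\eta,x)+c_{\mathcal{L}}\,|\mathrm{supp}(\eta)|$. Lamplighter random walk: $(\mathbf{i}_n)_{n\ge1}$ are i.i.d. $\mathcal{L}$-valued with law $\mu$, $Z_0=(\mathbf{0},e)$, $Z_n=Z_{n-1}\mathbf{i}_n$, $Z_n=(\eta_n,X_n)$. Assumptions: $(Z_n)$ is irreducible (every element of $\mathcal{L}$ is reached from every other with positive probability) and transient, and (1) $\langle\mathrm{supp}(\mu)\rangle=\mathcal{L}$; (2) there is $R\ge0$ such that $\mu(\eta,x)>0$ implies $d(e,y)\le R$ for all $y\in\mathrm{supp}(\eta)$; (3) $\sum_{(\eta,x)\in\mathcal{L}}d(e,x)\mu(\eta,x)<\infty$. The projection $(X_n)$ is assumed transient. The following limits exist almost surely and are constant (Kingman's subadditive ergodic theorem): $\ell_0=\lim_n d(e,X_n)/n$, $\ell_{\mathrm{TS}}=\lim_n d_{\mathrm{TS}}(\eta_n,X_n)/n$, $\ell=\lim_n \ell(Z_n)/n$. *)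

(* Defs.v *)
From HB Require Import structures.
From mathcomp Require Import all_boot all_order all_algebra.
From mathcomp Require Import finmap.
From mathcomp Require Import all_classical all_reals all_analysis.
Set Implicit Arguments.
Unset Strict Implicit.
Unset Printing Implicit Defensive.
Import Order.TTheory GRing.Theory Num.Theory.
Import numFieldNormedType.Exports.

Local Open Scope classical_set_scope.
Local Open Scope ring_scope.

Section generation.
Variable G : groupType.

Definition symmetric_set (A : set G) : Prop :=
  forall x, A x -> A (x^-1)%g.

Definition semigroup_generated (A : set G) : set G :=
  smallest [set H : set G | mulg_closed (mem H)] A.

Definition group_generated (A : set G) : set G :=
  smallest [set H : set G | group_closed (mem H)] A.

End generation.

Section wordMetric.
Variables (R : realType) (G : groupType) (S : set G) (l : G -> R).

(* The set of lengths below is discrete and bounded below by 0, so its infimum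
   is a minimum as soon as the set is nonempty, i.e. as soon as S generates G.
   The empty word is allowed, so that the distance from x to x is 0. *)
Definition word_dist (x y : G) : R :=
  inf [set L | exists w : seq G,
         [/\ {in w, forall s, S s},
             y = (x * \prod_(s <- w) s)%g &
             L = \sum_(s <- w) l s]].

(* The path [:: x0; x1; ...; xn] is represented, as in the library, by its
   origin x0 and the sequence p = [:: x1; ...; xn] of its other vertices. *)
Definition cayley_path (x0 : G) (p : seq G) : bool :=
  path (fun x y : G => (x^-1 * y)%g \in S) x0 p.

Definition path_length (x0 : G) (p : seq G) : R :=
  \sum_(r <- pairmap (fun x y : G => l (x^-1 * y)%g) x0 p) r.

End wordMetric.

Section lamplighterGroup.
Variable G : groupType.

Definition config : Type := {fsfun G -> 'Z_2 with 0}.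
HB.instance Definition _ := Choice.on config.

Definition config0 : config := [fsfun with 0].

Definition config_add (eta1 eta2 : config) : config :=
  [fsfun w in (finsupp eta1 `|` finsupp eta2)%fset => eta1 w + eta2 w | 0].

Definition config_shift (x : G) (eta : config) : config :=
  [fsfun w in [fset (x * y)%g | y in finsupp eta]%fset => eta (x^-1 * w)%g | 0].

Lemma config0E w : config0 w = 0.
Proof. exact: fsfun0E. Qed.

Lemma config_addE eta1 eta2 w : config_add eta1 eta2 w = eta1 w + eta2 w.
Proof.
rewrite fsfun_fun inE; case: (boolP (_ || _)) => // /norP[h1 h2].
by rewrite !fsfun_dflt // addr0.
Qed.

Lemma config_shiftE x eta w : config_shift x eta w = eta (x^-1 * w)%g.
Proof.
rewrite fsfun_fun; case: ifPn => // h.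
rewrite fsfun_dflt //; apply: contra h => h.
by apply/imfsetP; exists (x^-1 * w)%g => //=; rewrite mulVKg.
Qed.

Lemma configP (eta1 eta2 : config) : eta1 =1 eta2 -> eta1 = eta2.
Proof. by move/fsfunP. Qed.

Definition lamplighter : Type := (config * G)%type.
HB.instance Definition _ := Choice.on lamplighter.

Definition lamp_one : lamplighter := (config0, 1%g).

Definition lamp_mul (g h : lamplighter) : lamplighter :=
  (config_add g.1 (config_shift g.2 h.1), (g.2 * h.2)%g).

(* Configurations are their own opposites, being valued in Z/2Z. *)
Definition lamp_inv (g : lamplighter) : lamplighter :=
  (config_shift (g.2^-1)%g g.1, (g.2^-1)%g).

Lemma lamp_mulA : associative lamp_mul.
Proof.
move=> [a x] [b y] [c z]; congr pair => /=; last exact: mulgA.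
apply: configP => w; rewrite !(config_addE, config_shiftE) addrA.
by rewrite invgM mulgA.
Qed.

Lemma lamp_mul1g : left_id lamp_one lamp_mul.
Proof.
move=> [a x]; congr pair => /=; last exact: mul1g.
by apply: configP => w; rewrite config_addE config_shiftE config0E add0r invg1 mul1g.
Qed.

Lemma lamp_mulg1 : right_id lamp_one lamp_mul.
Proof.
move=> [a x]; congr pair => /=; last exact: mulg1.
by apply: configP => w; rewrite config_addE config_shiftE config0E addr0.
Qed.

Lemma Z2_addrr (a : 'Z_2) : a + a = 0.
Proof. by case: a => -[|[|]] // i; apply: val_inj. Qed.

Lemma lamp_mulVg : left_inverse lamp_one lamp_inv lamp_mul.
Proof.
move=> [a x]; congr pair => /=; last exact: mulVg.
by apply: configP => w; rewrite config_addE config0E Z2_addrr.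
Qed.

Lemma lamp_mulgV : right_inverse lamp_one lamp_inv lamp_mul.
Proof.
move=> [a x]; congr pair => /=; last exact: mulgV.
apply: configP => w; rewrite config_addE !config_shiftE config0E invgK.
by rewrite mulVKg Z2_addrr.
Qed.

HB.instance Definition _ := isGroup.Build lamplighter
  lamp_mulA lamp_mul1g lamp_mulg1 lamp_mulVg lamp_mulgV.

HB.instance Definition _ := isPointed.Build lamplighter lamp_one.

HB.instance Definition _ := @isMeasurable.Build default_measure_display
  lamplighter discrete_measurable discrete_measurable0
  discrete_measurableC discrete_measurableU.

End lamplighterGroup.

Section lamplighterLength.
Variables (R : realType) (G : groupType) (S : set G) (l : G -> R) (c : R).

(* As for [word_dist], the infimum is a minimum when S generates G. *)
Definition dTS (g : lamplighter G) : R :=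
  inf [set L | exists p : seq G,
         [/\ cayley_path S 1%g p,
             last 1%g p = g.2,
             {subset finsupp g.1 <= 1%g :: p} &
             L = path_length l 1%g p]].

Definition lamp_length (g : lamplighter G) : R :=
  dTS g + c * #|` finsupp g.1|%:R.

End lamplighterLength.

Section probability.
Context (R : realType) d (Omega : measurableType d) (P : probability Omega R).

Definition mutually_independent d' (T : measurableType d')
    (X : nat -> {mfun Omega >-> T}) : Prop :=
  forall (J : {fset nat}) (A : nat -> set T), (forall i, measurable (A i)) ->
    P (\bigcap_(i in [set` J]) (X i @^-1` A i)) =
    (\prod_(i <- J) P (X i @^-1` A i))%E.

Definition iid_with_law d' (T : measurableType d')
    (X : nat -> {mfun Omega >-> T}) (mu : probability T R) : Prop :=
  mutually_independent X /\
  forall n (A : set T), measurable A -> distribution P (X n) A = mu A.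

Definition as_limit (X : nat -> Omega -> R) (a : R) : Prop :=
  {ae P, forall w, (fun n => X n w) @ \oo --> a}.

(* The walk started at 0 does not almost surely return to its origin. *)
Definition transient (T : Type) (X : nat -> Omega -> T) : Prop :=
  (P [set w | exists n, X n.+1 w = X 0%N w] < 1)%E.

End probability.

Section walk.
Context (R : realType) (G : groupType) d (Omega : measurableType d).
Context (P : probability Omega R) (inc : nat -> Omega -> lamplighter G).

(* Increments are numbered from 0: [inc n] is the (n+1)-st one. *)
Fixpoint walk_from (g : lamplighter G) (n : nat) (w : Omega) : lamplighter G :=
  if n is m.+1 then (walk_from g m w * inc m w)%g else g.

Definition lamp_walk : nat -> Omega -> lamplighter G := walk_from 1%g.

Definition irreducible_walk : Prop :=
  forall g h, exists n, (0 < P [set w | walk_from g n w = h])%E.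

End walk.

Definition law_support (R : realType) (G : groupType)
    (mu : probability (lamplighter G) R) : set (lamplighter G) :=
  [set g | (0 < mu [set g])%E].

(* Main.v *)
Require Import Defs.
From HB Require Import structures.
From mathcomp Require Import all_boot all_order all_algebra.
From mathcomp Require Import finmap.
From mathcomp Require Import all_classical all_reals all_analysis.
From mathcomp Require Import measurable_realfun.
From mathcomp Require Import zify ring lra.
Import Order.TTheory GRing.Theory Num.Theory.
Import numFieldNormedType.Exports.
Local Open Scope classical_set_scope.
Local Open Scope ring_scope.
Set Implicit Arguments.
Unset Strict Implicit.
Unset Printing Implicit Defensive.

(** The excess of a tour over the distance between its endpoints is called its
    waste.  The triangle inequality makes waste superadditive along a tour, so
    it is enough to find disjoint stretches of a tour which waste a fixed amount
    per step and have linearly many steps in total.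

    Geometry.  The star of y consists of y and its neighbours ys, s in S.  A
    tour that visits the star of y without wasting anything between the first
    and the last of these visits would embed the star isometrically in the real
    line.  This is impossible ([star_not_on_line]): a shortest generator s and
    its inverse (or, if s is an involution, s and the shortest generator t
    outside the subgroup of s) occupy the two sides of e on the line; a shortest
    generator u outside the subgroup generated by this symmetric pair would be
    on the side of one of them, at a distance from it less than the length of
    u, and so belong to that subgroup after all; hence the pair would generate
    G.  As there are finitely many short words, the waste of a stretch covering
    a star is bounded below by a multiple of its number of steps
    ([star_waste]).  Choosing disjoint stretches greedily, the longest first,
    gives d_TS(eta, x) >= d(e, x) + c N for every (eta, x), where N is the
    number of stars on which eta is 1 everywhere ([tour_detour]).

    Probability.  Linearly many stars get completely lit ([many_lit]).
    Transience bounds the Green function, so from a suitable site the walk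
    avoids any given finite set forever with positive probability ([escape]).
    From any state, irreducibility lets the walk multiply, in boundedly many
    steps and with probability bounded below, by the element which turns on the
    missing lamps of the star around the present position and then steps to
    such a site; from there it never touches this star again.  Started at the
    times iT, i < K, for a large T, successes at different times light
    different stars.  Their expected number is at least aK out of K, hence with
    probability at least a/2 there are at least aK/2 of them.

    Therefore d_TS(Z_n) - d(e, X_n) exceeds a fixed multiple of n, along a
    subsequence, with probability bounded below, and this is incompatible with
    almost sure convergence of the two quotients to limits that are too close
    ([limit_gap]).  That ell_TS <= ell holds because d_TS <= ell pointwise. *)

(** * Disjoint intervals with large total length *)

(** The longest interval meets only intervals contained in its threefold
    enlargement, and distinct tags bound their number by four times its length;
    all others lie to its left or to its right, where the claim holds by
    induction, and superadditivity adds up the three contributions. *)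
Lemma interval_covering (R : realFieldType) (T : eqType) (w : nat -> nat -> R)
    (a t b : T -> nat) (c : R) (n : nat) :
  0 <= c ->
  (forall i j, (i <= j <= n)%N -> 0 <= w i j) ->
  (forall i j k, (i <= j <= k)%N -> (k <= n)%N -> w i j + w j k <= w i k) ->
  forall (s : seq T) i j, uniq s -> {in s &, injective t} ->
  (i <= j <= n)%N ->
  (forall y, y \in s -> [/\ (i <= a y <= t y)%N, (t y <= b y <= j)%N,
     c <= w (a y) (b y) & c * (b y - a y)%:R <= w (a y) (b y)]) ->
  c / 4 * (size s)%:R <= w i j.
Proof.
move=> c0 w0 wadd s; move: {2}(size s) (leqnn (size s)) => m.
elim: m s => [|m IH] s.
  by rewrite leqn0 => /nilP -> i j _ _ ij _; rewrite mulr0 w0.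
move=> sm i j us tinj ij hs.
case: (altP (s =P [::])) => [->|s0]; first by rewrite mulr0 w0.
have [y ys ymax] : exists2 y, y \in s &
    forall z, z \in s -> (b z - a z <= b y - a y)%N.
  case: s s0 {sm us tinj hs IH} => // y s _; elim: s y => [|x s IH] y.
    by exists y => [|z]; rewrite inE => // /eqP ->.
  have [u us umax] := IH x.
  case: (leqP (b u - a u)%N (b y - a y)%N) => h.
    exists y => [|z]; rewrite inE ?eqxx// => /orP[/eqP ->//|/umax zu].
    exact: leq_trans zu h.
  exists u => [|z]; rewrite inE ?us ?orbT// => /orP[/eqP ->|/umax//].
  exact: ltnW.
pose len := (b y - a y)%N.
pose sl := [seq z <- s | (b z <= a y)%N].
pose sr := [seq z <- s | (b y <= a z)%N].
pose sm' := [seq z <- s | (a z < b y)%N && (a y < b z)%N].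
have [/andP[iay aty] /andP[tby byj] yc yl] := hs y ys.
have jn : (j <= n)%N by case/andP: ij.
(* A longest interval of length 0 would have w = 0 by superadditivity, whence c <= 0. *)
have cy : (a y < b y)%N || (c == 0).
  rewrite ltnNge; apply/orP; case: leqP => //= ba; last by left.
  right; rewrite eq_le c0 andbT.
  have e : a y = b y by lia.
  move: yc; rewrite -e => yc.
  have := wadd (a y) (a y) (a y); rewrite !leqnn => /(_ isT).
  rewrite (leq_trans _ jn) ?(leq_trans _ byj) ?e// => /(_ isT).
  by rewrite -e; lra.
case/orP: cy => [aby|/eqP ->]; last by rewrite mul0r mul0r w0.
have ssz : (size s <= size sl + size sr + size sm')%N.
  rewrite !size_filter -[leqLHS](count_predT s) -addnA.
  elim: (s) => //= z s' IHs.
  by case: (leqP (b z) (a y)); case: (leqP (b y) (a z)) => /=; lia.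
have szlt (p : pred T) : ~~ p y -> (size [seq z <- s | p z] <= m)%N.
  move=> py; rewrite -ltnS; apply: leq_trans sm; rewrite size_filter.
  rewrite -[ltnRHS](count_predC p) -[ltnLHS]addn0 ltn_add2l -has_count.
  by apply/hasP; exists y.
have hl : c / 4 * (size sl)%:R <= w i (a y).
  apply: IH.
  - by apply: szlt; rewrite -ltnNge.
  - exact: filter_uniq.
  - by move=> u v; rewrite !mem_filter => /andP[_ us'] /andP[_ vs]; exact: tinj.
  - lia.
  - move=> z; rewrite mem_filter => /andP[bz zs].
    have [/andP[z1 z2] /andP[z3 z4] z5 z6] := hs z zs.
    by split => //; rewrite ?z1 ?z2 ?z3 ?bz.
have hr : c / 4 * (size sr)%:R <= w (b y) j.
  apply: IH.
  - by apply: szlt; rewrite -ltnNge.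
  - exact: filter_uniq.
  - by move=> u v; rewrite !mem_filter => /andP[_ us'] /andP[_ vs]; exact: tinj.
  - lia.
  - move=> z; rewrite mem_filter => /andP[bz zs].
    have [/andP[z1 z2] /andP[z3 z4] z5 z6] := hs z zs.
    by split => //; rewrite ?bz ?z2 ?z3 ?z4.
have szm : (size sm' <= 4 * len)%N.
  have -> : size sm' = size [seq t z | z <- sm'] by rewrite size_map.
  have -> : (4 * len = size (iota (a y - len) (4 * len)))%N by rewrite size_iota.
  apply: uniq_leq_size.
    rewrite map_inj_in_uniq ?filter_uniq// => u v.
    by rewrite !mem_filter => /andP[_ us'] /andP[_ vs]; exact: tinj.
  move=> _ /mapP[z + ->]; rewrite mem_filter => /andP[/andP[z1 z2] zs].
  have [/andP[z3 z4] /andP[z5 z6] _ _] := hs z zs.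
  have := ymax z zs; rewrite mem_iota /len.
  by clear -z1 z2 z3 z4 z5 z6 aby; lia.
have hm : c / 4 * (size sm')%:R <= w (a y) (b y).
  apply: le_trans yl; rewrite -/len.
  have : c / 4 * (size sm')%:R <= c / 4 * (4 * len)%:R.
    by rewrite ler_wpM2l ?divr_ge0// ler_nat.
  by rewrite natrM; lra.
have iay' := leq_trans iay aty.
have h1 := wadd i (a y) (b y); have h2 := wadd i (b y) j.
have {}h1 : w i (a y) + w (a y) (b y) <= w i (b y).
  by apply: h1; rewrite ?iay ?(ltnW aby)// (leq_trans byj jn).
have {}h2 : w i (b y) + w (b y) j <= w i j.
  by apply: h2; rewrite ?jn// (leq_trans iay (ltnW aby)).
have : c / 4 * (size s)%:R <= c / 4 * (size sl + size sr + size sm')%:R.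
  by rewrite ler_wpM2l ?divr_ge0// ler_nat.
rewrite !natrD !mulrDr; lra.
Qed.

(** * Generated subgroups and words *)

Section generation_facts.
Variable G : groupType.
Implicit Types A H : set G.

Definition subgroup_set H : Prop :=
  [/\ H 1%g, forall x y, H x -> H y -> H (x * y)%g & forall x, H x -> H x^-1%g].

Lemma group_generated_subgroup A : subgroup_set (group_generated A).
Proof.
have cl (M : set G) : group_closed (mem M) -> subgroup_set M.
  move=> cM; split.
  - by case: cM => + _; rewrite !inE.
  - by move=> x y Mx My; have := group_closedM cM; move/(_ x y); rewrite !inE; apply.
  - by move=> x Mx; have := group_closedV cM; move/(_ x); rewrite !inE; apply.
split.
- by move=> M [] /cl[].
- move=> x y Hx Hy M [cM AM]; have [_ MM _] := cl _ cM.
  by apply: MM; [apply: Hx|apply: Hy].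
- move=> x Hx M [cM AM]; have [_ _ MV] := cl _ cM.
  by apply: MV; apply: Hx.
Qed.

Lemma semigroup_generated_words A x : semigroup_generated A x ->
  exists w : seq G, [/\ {in w, forall s, A s}, x = (\prod_(s <- w) s)%g
    & w != [::]].
Proof.
have := @smallest_sub _ [set H : set G | mulg_closed (mem H)] A
  [set x | exists w : seq G, [/\ {in w, forall s, A s}, x = (\prod_(s <- w) s)%g
    & w != [::]]].
apply => [y z|y Ay].
  rewrite !inE => -[w1 [w1A -> w10]] [w2 [w2A -> _]].
  exists (w1 ++ w2); split; last by case: w1 w10 {w1A}.
  - by move=> s; rewrite mem_cat => /orP[/w1A|/w2A].
  - by rewrite big_cat.
exists [:: y]; split => //; last by rewrite big_seq1.
by move=> s; rewrite inE => /eqP ->.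
Qed.

End generation_facts.

(** * Points on one side of the origin *)

Section real_line.
Variable R : realDomainType.
Implicit Types a b m : R.

Lemma same_side_dist a b m : a != 0 -> b != 0 -> `|a| <= m -> `|b| <= m ->
  0 <= a * b -> `|a - b| < m.
Proof.
move=> a0 b0 am bm ab; rewrite ltr_norml.
move: am bm; rewrite !ler_norml => /andP[am am'] /andP[bm bm'].
case: (ltrgt0P a) a0 => // a0 _.
- have b0' : 0 < b by rewrite lt_neqAle eq_sym b0 -(pmulr_rge0 _ a0).
  by apply/andP; split; lra.
- have b0' : b < 0 by rewrite lt_neqAle b0 -(nmulr_rge0 _ a0).
  by apply/andP; split; lra.
Qed.

Lemma same_side_norm_inj a b : `|a| = `|b| -> 0 < a * b -> a = b.
Proof.
move=> e ab; have := congr1 (fun z => z ^+ 2) e; rewrite !real_normK ?num_real//.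
move/eqP; rewrite eqf_sqr => /orP[/eqP//|/eqP aE].
by move: ab; rewrite aE mulNr -expr2 oppr_gt0 ltNge sqr_ge0.
Qed.

Lemma sign_cycle a b m : a * b < 0 -> a * m < 0 -> 0 < b * m.
Proof.
case: (ltrgt0P a) => a0; last by rewrite a0 mul0r ltxx.
- by rewrite !pmulr_rlt0// => b0 m0; rewrite nmulr_rgt0.
- by rewrite !nmulr_rlt0// => b0 m0; rewrite pmulr_rgt0.
Qed.

End real_line.

(** * The word metric *)

Section wordDistance.
Variables (R : realType) (G : groupType) (S : set G) (l : G -> R).
Hypothesis finS : finite_set S.
Hypothesis symS : symmetric_set S.
Hypothesis S1 : ~ S 1%g.
Hypothesis genS : semigroup_generated S = [set: G].
Hypothesis lS : forall s, S s -> 0 < l s /\ l (s^-1)%g = l s.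

Local Notation dist := (word_dist S l).
Local Notation wlen w := (\sum_(s <- w) l s).
Local Notation wprod w := (\prod_(s <- w) s)%g.

Let wlen_ge0 (w : seq G) : {in w, forall s, S s} -> 0 <= wlen w.
Proof.
by move=> wS; rewrite big_seq; apply: sumr_ge0 => s /wS /lS[/ltW].
Qed.

Let lengths x y := [set L | exists w : seq G,
  [/\ {in w, forall s, S s}, y = (x * wprod w)%g & L = wlen w]].

Let lengths_lb x y : has_lbound (lengths x y).
Proof. by exists 0 => _ [w [wS _ ->]]; exact: wlen_ge0. Qed.

Lemma exists_word x y :
  exists w : seq G, {in w, forall s, S s} /\ y = (x * wprod w)%g.
Proof.
have /semigroup_generated_words[w [wS e _]] :
  semigroup_generated S (x^-1 * y)%g by rewrite genS.
by exists w; split=> //; rewrite -e mulVKg.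
Qed.

Let lengths_inf x y : has_inf (lengths x y).
Proof.
split; last exact: lengths_lb.
by have [w [wS e]] := exists_word x y; exists (wlen w), w.
Qed.

Lemma dist_le_word x w : {in w, forall s, S s} -> dist x (x * wprod w)%g <= wlen w.
Proof. by move=> wS; apply: ge_inf; [exact: lengths_lb|exists w]. Qed.

Lemma dist_lt_word x y r : dist x y < r ->
  exists w : seq G, [/\ {in w, forall s, S s}, y = (x * wprod w)%g & wlen w < r].
Proof.
move=> dr; have [_ [w [wS e ->]] h] := inf_adherent (ltac:(lra) : 0 < r - dist x y)
  (lengths_inf x y).
exists w; split => //; move: h; rewrite -/(dist x y); lra.
Qed.

Lemma dist_ge x y r :
  (forall w : seq G, {in w, forall s, S s} -> y = (x * wprod w)%g -> r <= wlen w) ->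
  r <= dist x y.
Proof.
move=> h; apply: lb_le_inf; first by have [] := lengths_inf x y.
by move=> _ [w [wS e ->]]; exact: h.
Qed.

Lemma dist_ge0 x y : 0 <= dist x y.
Proof. by apply: dist_ge => w wS _; exact: wlen_ge0. Qed.

Lemma distxx x : dist x x = 0.
Proof.
apply/eqP; rewrite eq_le dist_ge0 andbT.
by have := @dist_le_word x [::]; rewrite !big_nil mulg1; apply.
Qed.

Lemma dist_translate z x y : dist (z * x)%g (z * y)%g = dist x y.
Proof.
congr inf; apply/seteqP; split => _ [w [wS e ->]]; exists w; split => //.
  by apply: (mulgI z); rewrite e mulgA.
by rewrite e mulgA.
Qed.

Lemma dist_triangle y x z : dist x z <= dist x y + dist y z.
Proof.
apply/ler_addgt0Pr => e e0.
have [|w1 [w1S e1 h1]] := @dist_lt_word x y (dist x y + e / 2); first lra.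
have [|w2 [w2S e2 h2]] := @dist_lt_word y z (dist y z + e / 2); first lra.
have := @dist_le_word x (w1 ++ w2); rewrite !big_cat/= mulgA -e1 -e2 => h.
have : dist x z <= wlen w1 + wlen w2.
  by apply: h => s; rewrite mem_cat => /orP[/w1S|/w2S].
lra.
Qed.

Let dist_symW x y : dist y x <= dist x y.
Proof.
apply: dist_ge => w wS e.
have := @dist_le_word y [seq s^-1%g | s <- rev w].
have -> : (y * wprod [seq s^-1%g | s <- rev w] = x)%g.
  rewrite {}e => {wS}; elim/last_ind: w => [|w t IH]; first by rewrite !big_nil !mulg1.
  rewrite rev_rcons map_cons big_cons -cats1 big_cat/= big_seq1.
  by rewrite !mulgA mulgK.
rewrite big_map (perm_big w) /=; last by rewrite perm_rev.
move=> h; apply: (le_trans (h _)).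
  by move=> _ /mapP[s sw ->]; apply: symS; apply: wS; rewrite mem_rev in sw.
by rewrite le_eqVlt; apply/orP; left; apply/eqP/eq_big_seq => s /wS /lS[].
Qed.

Lemma dist_sym x y : dist x y = dist y x.
Proof. by apply/eqP; rewrite eq_le !dist_symW. Qed.

Lemma dist_gen s : S s -> dist 1%g s <= l s.
Proof.
move=> Ss; have := @dist_le_word 1%g [:: s]; rewrite !big_seq1 mul1g; apply.
by move=> t; rewrite inE => /eqP ->.
Qed.

Lemma generator_length_min : exists2 m : R, 0 < m & forall s, S s -> m <= l s.
Proof.
have /finite_seqP[e eS] := finS.
suff [m m0 h] : exists2 m : R, 0 < m & forall s, s \in e -> S s -> m <= l s.
  by exists m => // s Ss; apply: h => //; move: Ss; rewrite eS.
move=> {eS}; elim: e => [|s e [m m0 h]]; first by exists 1.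
case: (pselect (S s)) => Ss; last first.
  by exists m => // t; rewrite inE => /orP[/eqP ->//|]; exact: h.
exists (Num.min m (l s)); first by rewrite lt_min m0 (lS Ss).1.
move=> t; rewrite inE ge_min => /orP[/eqP ->|te St]; rewrite ?lexx ?orbT//.
by rewrite h.
Qed.

Lemma wlen_ge m (w : seq G) : (forall s, S s -> m <= l s) ->
  {in w, forall s, S s} -> m * (size w)%:R <= wlen w.
Proof.
move=> hm; elim: w => [|s w IH] wS; first by rewrite big_nil mulr0.
rewrite big_cons /= -natr1 mulrDr mulr1 addrC lerD//; first by apply/hm/wS/mem_head.
by apply: IH => t tw; apply: wS; rewrite inE tw orbT.
Qed.

Lemma dist_gt0 x y : x != y -> 0 < dist x y.
Proof.
move=> xy; have [m m0 hm] := generator_length_min.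
apply: (lt_le_trans m0); apply: dist_ge => w wS e.
apply: le_trans (wlen_ge hm wS).
case: w {wS} e xy => [->|s w _ _]; first by rewrite big_nil mulg1 eqxx.
by rewrite -[leLHS]mulr1 ler_pM2l//= ler1n.
Qed.

(** * A star does not embed in a line *)

Definition minimal_outside (H : set G) u : Prop :=
  [/\ S u, ~ H u & forall v, S v -> ~ H v -> l u <= l v].

Lemma exists_minimal_outside H : ~ (S `<=` H) -> exists u, minimal_outside H u.
Proof.
move=> /existsNP[u0 /not_implyP[Su0 Hu0]].
have /finite_seqP[e eS] := finS.
suff [u [ue [Su Hu] h]] : exists u, [/\ u \in e, S u /\ ~ H u &
    forall v, v \in e -> S v -> ~ H v -> l u <= l v].
  by exists u; split => // v Sv Hv; apply: h => //; move: Sv; rewrite eS.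
have : u0 \in e by move: Su0; rewrite eS.
move=> {eS}; elim: e u0 Su0 Hu0 => // s e IH u0 Su0 Hu0.
case: (pselect (exists2 v, v \in e & S v /\ ~ H v)) => [[v ve [Sv Hv]] _|ne].
  have [u [ue [Su Hu] h]] := IH v Sv Hv ve.
  case: (pselect (S s /\ ~ H s)) => [[Ss Hs]|nSs].
    case: (leP (l s) (l u)) => lsu.
      exists s; split; rewrite ?mem_head// => z; rewrite inE => /orP[/eqP ->//|ze Sz Hz].
      exact: le_trans lsu (h _ _ _ _).
    exists u; split; rewrite ?inE ?ue ?orbT// => z; rewrite inE.
    by move=> /orP[/eqP -> _ _|]; [exact: ltW|exact: h].
  exists u; split; rewrite ?inE ?ue ?orbT// => z; rewrite inE.
  by move=> /orP[/eqP -> Ss Hs|]; [case: nSs|exact: h].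
rewrite inE => /orP[/eqP e0|ue]; last by case: ne; exists u0.
exists u0; split; rewrite ?e0 ?mem_head -?e0// => z.
rewrite inE => /orP[/eqP ->|ze Sz Hz]; first by rewrite e0.
by case: ne; exists z.
Qed.

(** An element at distance less than r is a product of generators each shorter
    than r. *)
Lemma short_in_subgroup H r x : subgroup_set H ->
  (forall v, S v -> l v < r -> H v) -> dist 1%g x < r -> H x.
Proof.
move=> [H1 HM _] Hv /dist_lt_word[w [wS -> ]]; rewrite mul1g.
elim: w wS => [|s w IH] wS; rewrite ?big_nil// !big_cons => wr.
have Ss : S s by apply/wS/mem_head.
have wS' : {in w, forall s, S s} by move=> t tw; apply: wS; rewrite inE tw orbT.
have := wlen_ge0 wS'; have := (lS Ss).1 => ls0 w0.
apply: HM; first by apply: Hv => //; lra.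
apply: IH => //; lra.
Qed.

(** If u and v were on the same side of 1, then d(v, u) would be the difference
    of their distances to 1, which is less than the length of u.  So v^-1 u
    would be a product of generators shorter than u, all of which belong to H
    by minimality, and u would be in H. *)
Lemma opposite_sides H u v (tau : G -> R) : subgroup_set H ->
  minimal_outside H u -> S v -> H v -> l v <= l u ->
  dist 1%g u = `|tau u - tau 1%g| -> dist 1%g v = `|tau v - tau 1%g| ->
  dist v u = `|tau u - tau v| ->
  (tau u - tau 1%g) * (tau v - tau 1%g) < 0.
Proof.
move=> sH [Su Hu umin] Sv Hv lvu du dv duv.
rewrite ltNge; apply/negP => same.
have [H1 HM HV] := sH.
apply: Hu; have -> : u = (v * (v^-1 * u))%g by rewrite mulVKg.
apply: HM => //; apply: (@short_in_subgroup H (l u)) => //.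
  move=> z Sz zu; apply: contrapT => Hz; have := umin _ Sz Hz; lra.
rewrite -(dist_translate v) mulg1 mulVKg duv.
have -> : tau u - tau v = (tau u - tau 1%g) - (tau v - tau 1%g).
  by rewrite opprB addrA subrK.
have u1 : 1%g != u by apply/eqP => e; apply: S1; rewrite e.
have v1 : 1%g != v by apply/eqP => e; apply: S1; rewrite e.
apply: same_side_dist same.
- by rewrite -normr_gt0 -du dist_gt0.
- by rewrite -normr_gt0 -dv dist_gt0.
- by rewrite -du; exact: dist_gen.
- by rewrite -dv (le_trans (dist_gen Sv)).
Qed.

Definition on_line (A : set G) : Prop :=
  exists tau : G -> R, forall x y, A x -> A y -> dist x y = `|tau x - tau y|.

Hypothesis no_symmetric_pair :
  ~ exists s s' : G, [/\ [set s; s'] `<=` S, symmetric_set [set s; s'] &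
                         group_generated [set s; s'] = [set: G]].

Local Notation star := (1%g |` S).

(** Let s be a shortest generator.  If s is not an involution, then s and s^-1
    are on opposite sides of 1, and a minimal generator u outside the subgroup
    they generate cannot be opposite to both.  If s is an involution, a minimal
    generator t outside its subgroup is opposite to s, and so is t^-1, at the
    same distance from 1: hence t is an involution too, and the previous
    argument applies to the pair s, t. *)
Lemma star_not_on_line : ~ on_line star.
Proof.
move=> [tau htau].
have h1 s : S s -> dist 1%g s = `|tau s - tau 1%g|.
  by move=> Ss; rewrite distrC htau//; [left|right].
have h2 s t : S s -> S t -> dist t s = `|tau s - tau t|.
  by move=> Ss St; rewrite distrC htau//; right.
have sub1 : ~ S `<=` [set 1%g].
  move=> S0; have /semigroup_generated_words[[|s w] [wS _ //]] :
    semigroup_generated S 1%g by rewrite genS.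
  by move=> _; have /wS Ss := mem_head s w; apply: S1; rewrite -(S0 _ Ss).
have inj s t : S s -> S t -> l t = l s -> dist 1%g s = dist 1%g t ->
    0 < (tau s - tau 1%g) * (tau t - tau 1%g) -> s = t.
  move=> Ss St lst; rewrite !h1// => dst pos; apply/eqP; apply: contraT => st.
  have := dist_gt0 st; rewrite h2//.
  have -> : tau t - tau s = (tau t - tau 1%g) - (tau s - tau 1%g).
    by rewrite opprB addrA subrK.
  by rewrite (same_side_norm_inj dst pos) subrr normr0 ltxx.
have dV s : dist 1%g s = dist 1%g s^-1%g.
  by rewrite dist_sym -(dist_translate s^-1) mulVg mulg1.
have gen2 s t : S s -> S t -> symmetric_set [set s; t] ->
    ~ S `<=` group_generated [set s; t].
  move=> Ss St sym sub; apply: no_symmetric_pair; exists s, t; split => //.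
    by move=> _ [->|->].
  apply/seteqP; split => // x _.
  have /semigroup_generated_words[w [wS -> _]] : semigroup_generated S x by rewrite genS.
  have [g1 gM _] := group_generated_subgroup [set s; t].
  elim: w wS => [|z w IH] wS; rewrite ?big_nil ?big_cons//.
  by apply: gM; [by apply: sub; apply: wS; rewrite mem_head|apply: IH => y yw; apply: wS; rewrite inE yw orbT].
have [s [Ss _ smin]] := exists_minimal_outside sub1.
have {}smin v : S v -> l s <= l v.
  by move=> Sv; apply: smin => // v1; apply: S1; rewrite -v1.
have SsV := symS Ss; have lsV := (lS Ss).2.
have ing (a b : G) : group_generated [set a; b] a /\ group_generated [set a; b] b.
  by split; apply: sub_gen_smallest; [left|right].
case: (eqVneq s s^-1%g) => [sV|sV].
- have sym : symmetric_set [set s; s] by move=> _ [->|->]; rewrite -sV; left.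
  have [t mt] := exists_minimal_outside (gen2 s s Ss Ss sym).
  have sg := group_generated_subgroup [set s; s].
  have [g1 gM gV] := sg.
  have mtV : minimal_outside (group_generated [set s; s]) t^-1%g.
    case: mt => St Ht tmin; split; first exact: symS.
      by move=> /gV; rewrite invgK.
    by move=> v Sv Hv; rewrite (lS St).2; exact: tmin.
  have opp v : minimal_outside (group_generated [set s; s]) v ->
      (tau v - tau 1%g) * (tau s - tau 1%g) < 0.
    move=> mv; have [Sv _ _] := mv.
    apply: (opposite_sides sg mv) => //; [exact: (ing _ _).1|exact: smin| | |];
    by [apply: h1|apply: h2].
  have ot := opp _ mt; have otV := opp _ mtV.
  have [St Ht tmin] := mt; have StV := symS St.
  have tV : t = t^-1%g.
    by apply: inj => //; [rewrite (lS St).2|apply: (@sign_cycle _ (tau s - tau 1%g)); rewrite mulrC].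
  have symst : symmetric_set [set s; t].
    by move=> _ [->|->]; rewrite -?sV -?tV; [left|right].
  have sg' := group_generated_subgroup [set s; t].
  have [u mu] := exists_minimal_outside (gen2 s t Ss St symst).
  have [Su Hu _] := mu.
  (* u is outside the larger subgroup of s and t, so minimality of t applies. *)
  have tu : l t <= l u.
    apply: tmin => //; apply: contra_not Hu; apply: sub_smallest2r.
      have [k1 kM kV] := sg'; split; first exact: mem_set.
      by move=> x y /set_mem Hx /set_mem Hy; apply: mem_set; apply: (kM _ _ Hx); exact: kV.
    by move=> _ [->|->]; left.
  have o1 : (tau u - tau 1%g) * (tau s - tau 1%g) < 0.
    apply: (opposite_sides sg' mu) => //; [exact: (ing _ _).1|exact: smin| | |];
    by [apply: h1|apply: h2].
  have o2 : (tau u - tau 1%g) * (tau t - tau 1%g) < 0.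
    apply: (opposite_sides sg' mu) => //; [exact: (ing _ _).2| | |];
    by [apply: h1|apply: h2].
  by have := sign_cycle o1 o2; rewrite mulrC ltNge (ltW ot).
- have sym : symmetric_set [set s; s^-1%g].
    by move=> _ [->|->]; rewrite ?invgK; [right|left].
  have [u mu] := exists_minimal_outside (gen2 s s^-1%g Ss SsV sym).
  have [Su _ _] := mu.
  have sg := group_generated_subgroup [set s; s^-1%g].
  have o1 : (tau u - tau 1%g) * (tau s - tau 1%g) < 0.
    apply: (opposite_sides sg mu) => //; [exact: (ing _ _).1|exact: smin| | |];
    by [apply: h1|apply: h2].
  have o2 : (tau u - tau 1%g) * (tau s^-1%g - tau 1%g) < 0.
    apply: (opposite_sides sg mu) => //; [exact: (ing _ _).2|by rewrite lsV; exact: smin| | |];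
    by [apply: h1|apply: h2].
  move/eqP: sV; apply; apply: inj => //.
  exact: sign_cycle o1 o2.
Qed.

(** * Waste along a path *)

Definition steps_in (x : nat -> G) (n : nat) : Prop :=
  forall k, (k < n)%N -> S ((x k)^-1 * x k.+1)%g.

Definition segment_length (x : nat -> G) (i j : nat) : R :=
  \sum_(i <= k < j) l ((x k)^-1 * x k.+1)%g.

Definition waste (x : nat -> G) (i j : nat) : R :=
  segment_length x i j - dist (x i) (x j).

Definition segment_word (x : nat -> G) (i j : nat) : seq G :=
  [seq ((x k)^-1 * x k.+1)%g | k <- index_iota i j].

Lemma segment_word_in x n i j : steps_in x n -> (j <= n)%N ->
  {in segment_word x i j, forall s, S s}.
Proof.
move=> xS jn s /mapP[k]; rewrite mem_index_iota => /andP[_ kj] ->.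
by apply: xS; exact: leq_trans kj jn.
Qed.

Lemma segment_word_prod x i j : (i <= j)%N ->
  (x i * wprod (segment_word x i j) = x j)%g.
Proof.
rewrite big_map => /subnKC <-; elim: (j - i)%N => [|k IH].
  by rewrite addn0 big_geq// mulg1.
by rewrite addnS big_nat_recr ?leq_addr//= mulgA IH mulVKg.
Qed.

Lemma segment_lengthE x i j : segment_length x i j = wlen (segment_word x i j).
Proof. by rewrite big_map. Qed.

Lemma waste_ge0 x n i j : steps_in x n -> (i <= j <= n)%N -> 0 <= waste x i j.
Proof.
move=> xS /andP[ij jn]; rewrite subr_ge0 segment_lengthE -{1}(segment_word_prod x ij).
exact/dist_le_word/(segment_word_in xS).
Qed.

Lemma segment_length_cat x i j k : (i <= j <= k)%N ->
  segment_length x i j + segment_length x j k = segment_length x i k.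
Proof. by move=> /andP[ij jk]; rewrite /segment_length -big_cat_nat. Qed.

Lemma waste_superadditive x i j k : (i <= j <= k)%N ->
  waste x i j + waste x j k <= waste x i k.
Proof.
move=> ijk; rewrite /waste -(segment_length_cat x ijk).
have := dist_triangle (x j) (x i) (x k); lra.
Qed.

(** By superadditivity a stretch without waste has no wasteful part, so the
    arc length from its start is an isometry to the line on the visited points.
    Only a translate y A needs to be visited, as distances are
    left invariant. *)
Lemma no_waste_on_line x n i j y (A : set G) : steps_in x n -> (i <= j <= n)%N ->
  waste x i j = 0 ->
  (forall z, A z -> exists2 k, (i <= k <= j)%N & x k = (y * z)%g) -> on_line A.
Proof.
move=> xS /andP[ij jn] w0 cov.
have geo a b : (i <= a <= b)%N -> (b <= j)%N ->
    dist (x a) (x b) = segment_length x a b.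
  move=> /andP[ia ab] bj.
  have := waste_superadditive x (i := i) (j := a) (k := j).
  have := waste_superadditive x (i := a) (j := b) (k := j).
  rewrite ia ab bj (leq_trans ab bj) => /(_ isT) h1 /(_ isT) h2.
  have h3 : 0 <= waste x i a by apply: waste_ge0 xS _; lia.
  have h4 : 0 <= waste x b j by apply: waste_ge0 xS _; lia.
  have h5 : 0 <= waste x a b by apply: waste_ge0 xS _; lia.
  have : waste x a b = 0 by lra.
  by rewrite /waste; lra.
have [k hk] : exists k : G -> nat,
    forall z, A z -> (i <= k z <= j)%N /\ x (k z) = (y * z)%g.
  have /choice[k hk] : forall z, exists k : nat,
      A z -> (i <= k <= j)%N /\ x k = (y * z)%g.
    move=> z; case: (pselect (A z)) => [/cov[k]|]; last by exists 0.
    by exists k.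
  by exists k.
exists (fun z => segment_length x i (k z)).
have main u v : A u -> A v -> (k u <= k v)%N -> dist u v =
    segment_length x i (k v) - segment_length x i (k u).
  move=> /hk[iu eu] /hk[iv ev] kuv.
  rewrite -(dist_translate y) -eu -ev geo ?kuv ?andbT; try lia.
  by rewrite -(segment_length_cat x (i := i) (j := k u) (k := k v)) ?kuv ?andbT; [ring|lia].
move=> u v Au Av; case: (leqP (k u) (k v)) => [kuv|/ltnW kuv].
- by rewrite distrC -main// ger0_norm// dist_ge0.
- by rewrite dist_sym -main// ger0_norm// dist_ge0.
Qed.

Lemma words_finite (M : nat) : exists ws : seq (seq G),
  forall w : seq G, {in w, forall s, S s} -> (size w <= M)%N -> w \in ws.
Proof.
have /finite_seqP[e eS] := finS.
elim: M => [|M [ws IH]].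
  by exists [:: [::]] => -[|s w].
exists ([::] :: [seq s :: w | s <- e, w <- ws]) => -[|s w] wS//= wM.
rewrite inE; apply/orP; right; apply/allpairsP; exists (s, w); split => //=.
  by have := wS s; rewrite eS /= mem_head; apply.
by apply: IH => // t tw; apply: wS; rewrite inE tw orbT.
Qed.

Lemma seq_min_pos (T : eqType) (s : seq T) (f : T -> R) :
  exists2 e : R, 0 < e & forall t, t \in s -> 0 < f t -> e <= f t.
Proof.
elim: s => [|u s [e e0 IH]]; first by exists 1.
case: (ltP 0 (f u)) => fu.
  exists (Num.min e (f u)); first by rewrite lt_min e0.
  move=> t; rewrite inE ge_min => /orP[/eqP ->|ts ft]; first by rewrite lexx orbT.
  by rewrite IH.
exists e => // t; rewrite inE => /orP[/eqP ->|]; last exact: IH.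
by rewrite ltNge fu.
Qed.

Lemma generator_length_max : exists2 m : R, 0 < m & forall s, S s -> l s <= m.
Proof.
have /finite_seqP[e eS] := finS.
suff [m m0 h] : exists2 m : R, 0 < m & forall s, s \in e -> l s <= m.
  by exists m => // s Ss; apply: h; move: Ss; rewrite eS.
move=> {eS}; elim: e => [|s e [m m0 h]]; first by exists 1.
exists (Num.max m (l s)); first by rewrite lt_max m0.
move=> t; rewrite inE le_max => /orP[/eqP ->|te]; first by rewrite lexx orbT.
by rewrite h.
Qed.

(** The waste of a stretch depends only on its word, and there are finitely
    many words of at most M letters. *)
Lemma short_waste_gap (M : nat) : exists2 e : R, 0 < e & forall x n i j,
  steps_in x n -> (i <= j <= n)%N -> (j - i <= M)%N -> waste x i j != 0 ->
  e <= waste x i j.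
Proof.
have [ws hws] := words_finite M.
have [e e0 he] := seq_min_pos ws (fun w => wlen w - dist 1%g (wprod w)).
exists e => // x n i j xS ijn jiM w0; have := waste_ge0 xS ijn.
case/andP: ijn => ij jn.
have -> : waste x i j = wlen (segment_word x i j) - dist 1%g (wprod (segment_word x i j)).
  rewrite /waste segment_lengthE -{1}(segment_word_prod x ij).
  by rewrite -{1}(mulg1 (x i)) dist_translate.
move=> wge; apply: he.
  by apply: hws; [exact: segment_word_in xS jn|rewrite size_map size_iota].
rewrite lt_neqAle wge andbT eq_sym; apply: contra_neq w0 => <-.
rewrite /waste segment_lengthE -{1}(segment_word_prod x ij).
by rewrite -{1}(mulg1 (x i)) dist_translate.
Qed.

(** Two visits to the star of y are at distance at most 2L, where L bounds the
    generator lengths.  A stretch of j - i > M steps has length at least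
    m (j - i) >= 4L, where m is the least generator length, so it wastes at
    least half of its length; for shorter stretches the gap of
    [short_waste_gap] applies, as their waste is not 0. *)
Lemma star_waste : exists2 c0 : R, 0 < c0 & forall x n i j y,
  steps_in x n -> (i <= j <= n)%N ->
  (forall z, star z -> exists2 k, (i <= k <= j)%N & x k = (y * z)%g) ->
  star (y^-1 * x i)%g -> star (y^-1 * x j)%g ->
  c0 <= waste x i j /\ c0 * (j - i)%:R <= waste x i j.
Proof.
have [m m0 hm] := generator_length_min; have [L L0 hL] := generator_length_max.
have [M hM] : exists M : nat, 4 * L <= m * M%:R /\ (0 < M)%N.
  exists (Num.bound (4 * L / m)).+1; split => //.
  have b0 : 0 <= 4 * L / m by rewrite divr_ge0 ?mulr_ge0 ?ltW.
  have := archi_boundP b0; rewrite ltr_pdivrMr// [ltRHS]mulrC => h.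
  by apply: le_trans (ltW h) _; rewrite ler_pM2l// ler_nat.
case: hM => hM M0.
have [e e0 he] := short_waste_gap M.
exists (Num.min (e / M%:R) (m / 2)).
  by rewrite lt_min !divr_gt0// ltr0n.
move=> x n i j y xS ijn cov si sj; set c0 := Num.min _ _.
have c0e : c0 <= e / M%:R by rewrite ge_min lexx.
have c0m : c0 <= m / 2 by rewrite ge_min lexx orbT.
have MR0 : 0 < M%:R :> R by rewrite ltr0n.
have c0pos : 0 < c0 by rewrite lt_min !divr_gt0.
have ce : c0 * M%:R <= e by rewrite -ler_pdivlMr.
have M1 : 1 <= M%:R :> R by rewrite ler1n.
case: (leqP (j - i) M) => jiM.
  have we : e <= waste x i j.
    apply: (he _ _ _ _ xS ijn jiM); apply/eqP => w0.
    exact: star_not_on_line (no_waste_on_line xS ijn w0 cov).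
  have jiM' : (j - i)%:R <= M%:R :> R by rewrite ler_nat.
  by split; apply: le_trans we; apply: le_trans ce; [rewrite ler_peMr// ltW|rewrite ler_pM2l].
case/andP: ijn => ij jn.
have star_le z : star z -> dist 1%g z <= L.
  by move=> [->|Sz]; [rewrite distxx ltW|rewrite (le_trans (dist_gen Sz))// hL].
have dij : dist (x i) (x j) <= 2 * L.
  apply: le_trans (dist_triangle y _ _) _.
  rewrite mulr_natl mulr2n lerD//; last first.
    by rewrite -(dist_translate y^-1) mulVg star_le.
  by rewrite dist_sym -(dist_translate y^-1) mulVg star_le.
have wl : m * (j - i)%:R <= segment_length x i j.
  rewrite segment_lengthE; have := wlen_ge hm (segment_word_in (i := i) xS jn).
  by rewrite size_map size_iota.
have jiM' : m * M%:R <= m * (j - i)%:R by rewrite ler_pM2l// ler_nat ltnW.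
have ji1 : 1 <= (j - i)%:R :> R by rewrite (le_trans M1)// ler_nat ltnW.
have big : m / 2 * (j - i)%:R <= waste x i j by rewrite /waste; lra.
split; apply: le_trans big.
  by rewrite (le_trans c0m)// ler_peMr// divr_ge0// ltW.
by rewrite ler_pM2r// (lt_le_trans ltr01).
Qed.

(** * The detour forced by lit stars *)

Lemma word_path x (w : seq G) : {in w, forall s, S s} ->
  exists p : seq G, cayley_path S x p /\ last x p = (x * wprod w)%g.
Proof.
elim: w x => [|s w IH] x wS; first by exists [::]; rewrite big_nil mulg1.
have [|p [pp pl]] := IH (x * s)%g.
  by move=> t tw; apply: wS; rewrite inE tw orbT.
exists (x * s :: p)%g; rewrite big_cons mulgA; split => //=.
by rewrite /cayley_path /= mulKg mem_set//; apply: wS; rewrite mem_head.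
Qed.

(** A tour exists, so the infimum that defines [dTS] is over a nonempty set and
    is bounded below as soon as every tour is. *)
Lemma exists_tour (A : seq G) x y : exists p : seq G,
  [/\ cayley_path S x p, last x p = y & {subset A <= x :: p}].
Proof.
have step u v : exists p : seq G, cayley_path S u p /\ last u p = v.
  have [w [wS ->]] := exists_word u v; exact: word_path.
elim: A x => [|a A IH] x; first by have [p [pp pl]] := step x y; exists p.
have [p [pp pl]] := step x a; have [q [qp ql qA]] := IH a.
exists (p ++ q); split.
- by rewrite /cayley_path cat_path; apply/andP; split=> //; rewrite pl.
- by rewrite last_cat pl.
- rewrite -cat_cons => z; rewrite inE mem_cat => /orP[/eqP ->|/qA].
    by rewrite -pl mem_last.
  rewrite inE => /orP[/eqP ->|->]; last by rewrite orbT.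
  by rewrite -pl mem_last.
Qed.

(** To each y in Y corresponds the interval between the first and the last visit
    of the tour to the star of y, tagged by the first visit to y itself; tags
    are distinct, so the intervals can be counted by [interval_covering]. *)
Lemma tour_detour : exists2 c1 : R, 0 < c1 & forall (g : lamplighter G) (Y : seq G),
  uniq Y ->
  (forall y z, y \in Y -> star z -> (y * z)%g \in finsupp g.1) ->
  c1 * (size Y)%:R + dist 1%g g.2 <= dTS S l g.
Proof.
have [c0 c00 hc0] := star_waste.
exists (c0 / 4); first by rewrite divr_gt0.
move=> g Y uY hY; apply: lb_le_inf.
  have [p [pp pl pA]] := exists_tour (finsupp g.1) 1%g g.2.
  by exists (path_length l 1%g p), p.
move=> _ [p [pp pl pA ->]].
pose x k := nth 1%g (1%g :: p) k; pose n := size p.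
have xS : steps_in x n.
  by move=> k kn; have /(pathP 1%g)/(_ k kn)/set_mem := pp.
have x0 : x 0 = 1%g by [].
have xn : x n = g.2 by rewrite -pl -nth_last /x /n; case: (p).
have -> : path_length l 1%g p = segment_length x 0 n.
  rewrite /path_length (big_nth 0) size_pairmap /segment_length.
  by apply: eq_big_nat => k /andP[_ kn]; rewrite (nth_pairmap 1%g).
rewrite -lerBrDr -{1}x0 -xn -/(waste x 0 n).
pose P y := fun k : nat => `[< (k <= n)%N /\ star (y^-1 * x k)%g >].
have visit y z : y \in Y -> star z -> exists2 k, (k <= n)%N & x k = (y * z)%g.
  move=> yY sz; have /pA yz := hY _ _ yY sz.
  exists (index (y * z)%g (1%g :: p)); last by rewrite /x nth_index.
  by rewrite -ltnS; move: yz; rewrite -index_mem.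
have exP y : y \in Y -> exists k, P y k.
  move=> yY; have [k kn xk] := visit y 1%g yY (or_introl erefl).
  by exists k; apply/asboolP; split => //; rewrite xk mulKg; left.
have Pb y k : P y k -> (k <= n)%N by move=> /asboolP[].
have /choice[ab hab] : forall y, exists ab : nat * nat, y \in Y ->
    [/\ P y ab.1, P y ab.2 & forall k, P y k -> (ab.1 <= k <= ab.2)%N].
  move=> y; case: (boolP (y \in Y)) => yY; last by exists (0, 0)%N.
  case: (ex_minnP (exP y yY)) => a Pa amin.
  case: (ex_maxnP (exP y yY) (Pb y)) => b Pb' bmax.
  by exists (a, b) => _; split=> // k Pk /=; rewrite amin//= bmax.
apply: (interval_covering (a := fun y => (ab y).1) (b := fun y => (ab y).2)
  (t := fun y => index y (1%g :: p)) (n := n)) => //.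
- exact: ltW.
- by move=> i j; exact: waste_ge0.
- by move=> i j k ijk _; exact: waste_superadditive.
- move=> u v uinY vinY e.
  have up z : z \in Y -> z \in 1%g :: p.
    by move=> zY; apply: pA; rewrite -(mulg1 z); apply: hY => //; left.
  have {}e : index u (1%g :: p) = index v (1%g :: p) := e.
  by rewrite -(nth_index 1%g (up _ uinY)) -(nth_index 1%g (up _ vinY)) e.
- by rewrite leqnn.
move=> y yY; have [/asboolP[an sa] /asboolP[bn sb] hk] := hab y yY.
have yp : y \in 1%g :: p.
  by apply: pA; rewrite -(mulg1 y); apply: hY => //; left.
have /hk/andP[h1 h2] : P y (index y (1%g :: p)).
  apply/asboolP; split; first by rewrite -ltnS; move: yp; rewrite -index_mem.
  by rewrite /x nth_index// mulVg; left.
have [||w1 w2] := hc0 x n (ab y).1 (ab y).2 y xS _ _ sa sb.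
- by move: h1 h2 bn; clear; lia.
- move=> z sz; have [k kn xk] := visit y z yY sz; exists k => //.
  by apply: hk; apply/asboolP; split => //; rewrite xk mulKg.
by split=> //=; rewrite h2.
Qed.

(** * Finite balls and countability *)

Lemma ball_finite (r : R) : exists Q : seq G, forall y, dist 1%g y <= r -> y \in Q.
Proof.
have [m m0 hm] := generator_length_min.
have [ws hws] := words_finite (Num.bound ((r + 1) / m)).
exists [seq wprod w | w <- ws] => y yr.
have yr1 : dist 1%g y < r + 1 by rewrite (le_lt_trans yr)// ltrDl.
have [w [wS -> wr]] := dist_lt_word yr1.
rewrite mul1g; apply/mapP; exists w => //; apply: hws => //.
have h := wlen_ge hm wS.
have {}h : (size w)%:R < (r + 1) / m :> R.
  by rewrite ltr_pdivlMr// mulrC; exact: le_lt_trans h wr.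
rewrite -(ler_nat R) ltW// (lt_le_trans h)// ltW//.
by apply: archi_boundP; rewrite ltW// (le_lt_trans _ h).
Qed.

Lemma group_countable : exists code : G -> nat, injective code.
Proof.
have /finite_seqP[e eS] := finS.
have /choice[dec hdec] : forall x : G, exists ns : seq nat,
    x = (\prod_(s <- [seq nth 1%g e n | n <- ns]) s)%g.
  move=> x; have [w [wS ->]] := exists_word 1%g x; rewrite mul1g.
  exists [seq index s e | s <- w]; rewrite -map_comp big_map; apply: eq_big_seq => s sw /=.
  by rewrite nth_index//; have := wS s sw; rewrite eS.
by exists (choice.pickle \o dec) => x y /(pcan_inj choice.pickleK) e'; rewrite (hdec x) e' -hdec.
Qed.

Lemma lamplighter_countable : exists code : lamplighter G -> nat, injective code.
Proof.
have [cd cdI] := group_countable.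
pose f (g : lamplighter G) :=
  ([seq (cd x, val (g.1 x)) | x <- finsupp g.1], cd g.2).
exists (choice.pickle \o f) => -[a x] [b y] /(pcan_inj choice.pickleK)[e /cdI ->].
have vals (u v : config G) : [seq (cd x, val (u x)) | x <- finsupp u] =
    [seq (cd x, val (v x)) | x <- finsupp v] -> forall z, z \in finsupp u -> u z = v z.
  move=> huv z zu.
  have : (cd z, val (u z)) \in [seq (cd x, val (v x)) | x <- finsupp v].
    by rewrite -huv; apply/mapP; exists z.
  by case/mapP => z' _ [/cdI -> /val_inj].
congr pair; apply: configP => z.
case: (boolP (z \in finsupp a)) => [/(vals _ _ e)//|za].
case: (boolP (z \in finsupp b)) => [/(vals _ _ (esym e))//|zb].
by rewrite !fsfun_dflt.
Qed.
End wordDistance.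

(** * A lower bound for the number of successes *)

(** The number of the events that occur has mean at least aK, is at most K on F
    and at most aK/2 off F, so K P(F) + aK/2 >= aK. *)
Lemma reverse_markov (R : realType) d (Omega : measurableType d)
    (P : probability Omega R) (K : nat) (E : nat -> set Omega) (F : set Omega) (a : R) :
  (0 < K)%N -> 0 <= a -> (forall i, measurable (E i)) -> measurable F ->
  (forall i, (i < K)%N -> (a%:E <= P (E i))%E) ->
  (forall w, ~ F w -> \sum_(i < K) \1_(E i) w <= a / 2 * K%:R :> R) ->
  ((a / 2)%:E <= P F)%E.
Proof.
move=> K0 a0 mE mF hE hF.
have K0' : 0 < K%:R :> R by rewrite ltr0n.
have mf A : measurable A -> measurable_fun setT (EFin \o (\1_A : Omega -> R)).
  by move=> mA; apply/measurable_EFinP; exact: measurable_indic.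
have int1 : ((a * K%:R)%:E <= \int[P]_w (\sum_(i < K) (\1_(E i) w : R)%:E))%E.
  rewrite ge0_integral_sum//; last by move=> i; exact: mf (mE i).
  apply: (@le_trans _ _ (\sum_(i < K) a%:E)%E).
    by rewrite sumEFin sumr_const card_ord mulr_natr.
  by apply: lee_sum => i _; rewrite integral_indic// setIT hE.
have int2 : (\int[P]_w (\sum_(i < K) (\1_(E i) w : R)%:E) <=
    \int[P]_w (K%:R%:E * (\1_F w : R)%:E + (a / 2 * K%:R)%:E))%E.
  apply: ge0_le_integral => //.
  - by move=> w _; apply: sume_ge0 => i _; rewrite lee_fin.
  - by apply: emeasurable_sum => i; exact: mf (mE i).
  - apply: emeasurable_funD => //; apply: measurable_funeM.
    exact: mf mF.
  move=> w _; rewrite sumEFin -EFinM -EFinD lee_fin.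
  case: (pselect (F w)) => Fw.
    rewrite [\1_F w]indicE mem_set// mulr1.
    have : \sum_(i < K) (\1_(E i) w : R) <= \sum_(i < K) 1.
      by apply: ler_sum => i _; rewrite indicE; case: (_ \in _).
    rewrite sumr_const card_ord => h; apply: (le_trans h).
    by rewrite lerDl mulr_ge0// divr_ge0.
  by rewrite [\1_F w]indicE memNset// mulr0 add0r hF.
have := le_trans int1 int2.
rewrite ge0_integralD//; last 2 first.
- apply: measurable_funeM.
  exact: mf mF.
- by move=> w _; rewrite lee_fin mulr_ge0// divr_ge0.
rewrite ge0_integralZl//; last exact: mf mF.
rewrite integral_indic// setIT integral_cst//.
rewrite [X in (_ <= _ + _ * X)%E](_ : _ = 1%E); last exact: probability_setT.
rewrite mule1.
have fF : P F \is a fin_num by exact: fin_num_measure.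
move=> h.
have {}h : ((a * K%:R)%:E <= K%:R%:E * (fine (P F))%:E + (a / 2 * K%:R)%:E)%E.
  by rewrite fineK//; exact: h.
move: h; rewrite -EFinM -EFinD -(fineK fF) !lee_fin => h.
have : a / 2 * K%:R <= fine (P F) * K%:R by lra.
by rewrite ler_pM2r.
Qed.

(** * Random variables with countably many values *)

Section discrete_variables.
Context (R : realType) d (Omega : measurableType d) (P : probability Omega R).
Context (T : Type) (code : T -> nat).
Hypothesis codeI : injective code.

Definition discrete_variable (f : Omega -> T) : Prop :=
  forall t, measurable [set w | f w = t].

Let cell f k : [set w | code (f w) = k] = set0 \/
  exists t, [set w | code (f w) = k] = [set w : Omega | f w = t].
Proof.
case: (pselect (exists t, code t = k)) => [[t tk]|nt].
  right; exists t; apply/seteqP; split => w /= [h]; last by rewrite h.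
  by apply: codeI; rewrite h.
by left; apply/seteqP; split => w //= h; case: nt; exists (f w).
Qed.

Let cell_measurable f k : discrete_variable f -> measurable [set w | code (f w) = k].
Proof. by move=> mf; have [->|[t ->]] := cell f k; [exact: measurable0|exact: mf]. Qed.

(** The injection of T in nat turns an event into a countable disjoint union of
    events on which f is constant.  This gives measurability here, and below the
    comparison of two probabilities atom by atom. *)
Lemma discrete_preimage f (A : set T) : discrete_variable f ->
  measurable [set w | A (f w)].
Proof.
move=> mf.
have -> : [set w | A (f w)] = \bigcup_k [set w | A (f w) /\ code (f w) = k].
  by apply/seteqP; split => w /=; [move=> Aw; exists (code (f w))|case=> k _ []].
apply: bigcupT_measurable => k.
have -> : [set w | A (f w) /\ code (f w) = k] =
    [set w | A (f w)] `&` [set w | code (f w) = k] by [].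
have [->|[t ->]] := cell f k; first by rewrite setI0; exact: measurable0.
case: (pselect (A t)) => At.
  rewrite setIidr; first exact: mf.
  by move=> w /= ->.
rewrite (_ : _ `&` _ = set0); first exact: measurable0.
by apply/seteqP; split => w //= [] + wt; rewrite wt.
Qed.

Let sum_cells f (U : set Omega) : discrete_variable f -> measurable U ->
  (P U = \sum_(0 <= k <oo) P (U `&` [set w | code (f w) = k]))%E.
Proof.
move=> mf mU.
rewrite -measure_semi_bigcup.
- congr (P _); apply/seteqP; split => w /=; first by move=> Uw; exists (code (f w)).
  by case=> k _ [].
- by move=> k; apply: measurableI => //; exact: cell_measurable.
- by apply/trivIsetP => i j _ _ ij; apply/seteqP; split => w //= [[_ e1] [_ e2]];
    move: ij; rewrite -e1 -e2 eqxx.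
- by apply: bigcupT_measurable => k; apply: measurableI => //; exact: cell_measurable.
Qed.

Lemma le_prob_atoms f (U V : set Omega) (a : R) : discrete_variable f ->
  measurable U -> measurable V -> 0 <= a ->
  (forall t, (a%:E * P (U `&` [set w | f w = t]) <= P (V `&` [set w | f w = t]))%E) ->
  (a%:E * P U <= P V)%E.
Proof.
move=> mf mU mV a0 h; rewrite (sum_cells mf mU) (sum_cells mf mV).
rewrite -nneseriesZl; last by move=> *; exact: measure_ge0.
apply: lee_nneseries => k _ *; first by rewrite mule_ge0.
by have [->|[t ->]] := cell f k; [rewrite !setI0 !measure0 mule0|exact: h].
Qed.

Lemma eq_prob_atoms f f' (U V : set Omega) (a : R) :
  discrete_variable f -> discrete_variable f' ->
  measurable U -> measurable V ->
  (forall t, (a%:E * P (U `&` [set w | f w = t]) = P (V `&` [set w | f' w = t]))%E) ->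
  (a%:E * P U = P V)%E.
Proof.
move=> mf mf' mU mV h; rewrite (sum_cells mf mU) (sum_cells mf' mV).
rewrite -nneseriesZl; last by move=> *; exact: measure_ge0.
apply: eq_eseriesr => k _.
case: (pselect (exists t, code t = k)) => [[t <-]|nt].
  have e g : [set w | code (g w) = code t] = [set w : Omega | g w = t].
    by apply/seteqP; split => w /= [h']; [exact: codeI|rewrite h'].
  by rewrite !e h.
have e g : [set w : Omega | code (g w) = k] = set0.
  by apply/seteqP; split => w //= h'; case: nt; exists (g w).
by rewrite !e !setI0 !measure0 mule0.
Qed.

End discrete_variables.

(** * Independence of past and future increments *)

Section increments.
Context (R : realType) (G : groupType) d (Omega : measurableType d).
Context (P : probability Omega R) (mu : probability (lamplighter G) R).
Context (inc : nat -> {mfun Omega >-> lamplighter G}).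
Variable code : lamplighter G -> nat.
Hypothesis codeI : injective code.
Hypothesis iid : iid_with_law P inc mu.

Local Notation L := (lamplighter G).

Definition word_code (s : seq L) : nat := choice.pickle (map code s).

Lemma word_code_inj : injective word_code.
Proof. by move=> s t /(pcan_inj choice.pickleK); exact: inj_map. Qed.

Definition increments (i n : nat) (w : Omega) : seq L := [seq inc j w | j <- iota i n].

Lemma size_increments i n w : size (increments i n w) = n.
Proof. by rewrite size_map size_iota. Qed.

Lemma increments_cat i m n w :
  increments i (m + n) w = increments i m w ++ increments (i + m) n w.
Proof. by rewrite /increments iotaD map_cat. Qed.

Lemma discrete_increments i n : discrete_variable (increments i n).
Proof.
move=> s; elim: n i s => [|n IH] i s.
  case: s => [|a s].
    by rewrite (_ : mkset _ = setT); [exact: measurableT|apply/seteqP; split].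
  by rewrite (_ : mkset _ = set0); [exact: measurable0|apply/seteqP; split].
case: s => [|a s].
  by rewrite (_ : mkset _ = set0); [exact: measurable0|apply/seteqP; split].
rewrite (_ : mkset _ = (inc i @^-1` [set a]) `&` [set w | increments i.+1 n w = s]).
  apply: measurableI; last exact: IH.
  by rewrite -[_ @^-1` _]setTI; apply: (measurable_funPT (inc i)).
by apply/seteqP; split => w /=; rewrite /increments /= => -[-> ->].
Qed.

Lemma measurable_increments i n (A : set (seq L)) :
  measurable [set w | A (increments i n w)].
Proof. exact: (discrete_preimage word_code_inj _ (discrete_increments _ _)). Qed.

Lemma prob_increments_eq i n (s : seq L) : size s = n ->
  P [set w | increments i n w = s] = (\prod_(a <- s) mu [set a])%E.
Proof.
move=> sn; have [ind law] := iid.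
pose J : {fset nat} := [fset j in iota i n]%fset.
pose A j : set L := if (i <= j < i + n)%N then [set nth 1%g s (j - i)] else setT.
have -> : [set w | increments i n w = s] =
    \bigcap_(j in [set` J]) (inc j @^-1` A j).
  apply/seteqP; split => w /=.
    move=> e j; rewrite /= !inE mem_iota => ij.
    rewrite /A ij /= -e (nth_map 0%N) ?size_iota; last lia.
    by rewrite nth_iota; [congr (inc _ w); lia|lia].
  move=> h; apply: (@eq_from_nth _ 1%g); first by rewrite size_increments.
  move=> k; rewrite size_increments => kn.
  rewrite (nth_map 0%N) ?size_iota// nth_iota//.
  have := h (i + k)%N; rewrite /= !inE mem_iota /A leq_addr ltn_add2l kn => /(_ isT).
  by rewrite /= addKn.
rewrite ind; last by move=> j; exact: I.
rewrite (perm_big (iota i n)); last first.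
  apply: uniq_perm; rewrite ?fset_uniq ?iota_uniq// => j.
  by rewrite !inE.
rewrite -sn -[s in RHS](mkseq_nth 1%g) big_map.
rewrite -{1}(addn0 i) iotaDl big_map; apply: eq_big_seq => k /=.
rewrite mem_iota add0n sn => /= kn; rewrite -(law (i + k)%N)//=.
by rewrite /distribution /pushforward /A leq_addr ltn_add2l kn /= addKn.
Qed.

Let prob_fin i n A : P [set w | A (increments i n w)] \is a fin_num.
Proof. by apply: fin_num_measure; exact: measurable_increments. Qed.

(** When A and B are singletons, both sides are the product of the weights of
    the letters of a concatenated word.  B and then A are replaced by arbitrary
    sets of words by summing over their elements. *)
Lemma increments_independent i n (A B : set (seq L)) :
  P ([set w | A (increments 0 i w)] `&` [set w | B (increments i n w)]) =
  (P [set w | A (increments 0 i w)] * P [set w | B (increments 0 n w)])%E.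
Proof.
have base s t : P ([set w | increments 0 i w = s] `&` [set w | increments i n w = t]) =
    (P [set w | increments 0 i w = s] * P [set w | increments 0 n w = t])%E.
  have null k m (u : seq L) : size u <> m -> [set w | increments k m w = u] = set0.
    by move=> um; apply/seteqP; split => w //= e; apply: um; rewrite -e size_increments.
  case: (eqVneq (size s) i) => [si|/eqP si]; last first.
    by rewrite null// set0I measure0 mul0e.
  case: (eqVneq (size t) n) => [tn|/eqP tn]; last first.
    by rewrite !(null _ _ t)// setI0 measure0 mule0.
  rewrite !prob_increments_eq// -big_cat -(@prob_increments_eq 0 (i + n)%N); last first.
    by rewrite size_cat si tn.
  congr (P _); apply/seteqP; split => w /=; rewrite increments_cat add0n.
    by case=> -> ->.
  by move/eqP; rewrite eqseq_cat ?size_increments// => /andP[/eqP -> /eqP ->].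
have step1 s : P ([set w | increments 0 i w = s] `&` [set w | B (increments i n w)]) =
    (P [set w | increments 0 i w = s] * P [set w | B (increments 0 n w)])%E.
  rewrite -(fineK (prob_fin 0 i (eq^~ s))).
  apply/esym/(eq_prob_atoms word_code_inj (discrete_increments 0 n) (discrete_increments i n)).
  - exact: measurable_increments.
  - by apply: measurableI; [exact: (measurable_increments 0 i (eq^~ s))|exact: measurable_increments].
  move=> t; rewrite fineK; last exact: (prob_fin 0 i (eq^~ s)).
  rewrite -setIA.
  have e k : [set w | B (increments k n w)] `&` [set w | increments k n w = t] =
      (if pselect (B t) then [set w | increments k n w = t] else set0).
    case: pselect => Bt; apply/seteqP; split => w /=.
    - by case.
    - by move=> ->.
    - by case=> h wt; apply: Bt; rewrite -wt.
    - by [].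
  by rewrite !e; case: pselect => ?; [rewrite base|rewrite setI0 !measure0 mule0].
rewrite muleC -(fineK (prob_fin 0 n B)).
apply/esym/(eq_prob_atoms word_code_inj (discrete_increments 0 i) (discrete_increments 0 i)).
- exact: measurable_increments.
- by apply: measurableI; exact: measurable_increments.
move=> s; rewrite fineK; last exact: prob_fin.
rewrite setIAC muleC.
have e : [set w | A (increments 0 i w)] `&` [set w | increments 0 i w = s] =
    (if pselect (A s) then [set w | increments 0 i w = s] else set0).
  case: pselect => As; apply/seteqP; split => w /=.
  - by case.
  - by move=> ->.
  - by case=> h wt; apply: As; rewrite -wt.
  - by [].
by rewrite !e; case: pselect => ?; [rewrite step1|rewrite set0I !measure0 mul0e].
Qed.

(** The Markov property in the form of a lower bound: a future event that may
    depend on the past, but has conditional probability at least a whatever the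
    past, has probability at least a. *)
Lemma increments_markov i n (C : seq L -> set (seq L)) (a : R) : 0 <= a ->
  (forall s, (a%:E <= P [set w | C s (increments 0 n w)])%E) ->
  (a%:E <= P [set w | C (increments 0 i w) (increments i n w)])%E.
Proof.
move=> a0 hC.
have mC : [set w | C (increments 0 i w) (increments i n w)] =
    [set w | [set u | C (take i u) (drop i u)] (increments 0 (i + n) w)].
  apply/seteqP; split => w /=; rewrite increments_cat add0n.
    by rewrite take_size_cat ?drop_size_cat ?size_increments.
  by rewrite take_size_cat ?drop_size_cat ?size_increments.
rewrite -[leLHS]mule1 -(probability_setT P).
apply: (le_prob_atoms word_code_inj (discrete_increments 0 i)) => //.
  by rewrite mC; exact: measurable_increments.
move=> s; rewrite setTI.
have -> : [set w | C (increments 0 i w) (increments i n w)] `&`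
    [set w | increments 0 i w = s] =
    [set w | increments 0 i w = s] `&` [set w | C s (increments i n w)].
  by apply/seteqP; split => w /= [] => [+ e|e]; rewrite e.
rewrite (increments_independent i n (eq^~ s) (C s)) muleC lee_wpmul2l//.
Qed.

Lemma take_increments i m n w : (m <= n)%N ->
  take m (increments i n w) = increments i m w.
Proof.
by move=> mn; rewrite -(subnKC mn) increments_cat take_size_cat// size_increments.
Qed.

Lemma increments_split m n w : (m <= n)%N ->
  increments 0 n w = increments 0 m w ++ increments m (n - m) w.
Proof. by move=> mn; rewrite -{1}(subnKC mn) increments_cat. Qed.

Lemma drop_increments m n w : (m <= n)%N ->
  drop m (increments 0 n w) = increments m (n - m) w.
Proof.
by move=> mn; rewrite (increments_split w mn) drop_size_cat ?size_increments.
Qed.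

(** A word with a letter outside the support of mu has weight 0. *)
Lemma prob_increments_support n (A : set (seq L)) :
  (P [set w | A (increments 0 n w)] <=
   P [set w | A (increments 0 n w) /\
      {in increments 0 n w, forall g, law_support mu g}])%E.
Proof.
rewrite -[leLHS]mul1e.
apply: (le_prob_atoms word_code_inj (discrete_increments 0 n)) => //.
- exact: measurable_increments.
- exact: (measurable_increments 0 n [set s | A s /\ {in s, forall g, law_support mu g}]).
move=> s; rewrite mul1e.
case: (pselect {in s, forall g, law_support mu g}) => hs.
  apply: le_measure; rewrite ?inE; last first.
  - by move=> w /= [Aw ws]; split => //; split => //; rewrite ws.
  - apply: measurableI; last exact: discrete_increments.
    exact: (measurable_increments 0 n [set s | A s /\ {in s, forall g, law_support mu g}]).
  - by apply: measurableI; [exact: measurable_increments|exact: discrete_increments].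
rewrite (_ : P (_ `&` _) = 0%E) ?measure_ge0//.
apply/eqP; rewrite eq_le measure_ge0 andbT.
apply: (@le_trans _ _ (P [set w | increments 0 n w = s])).
  apply: le_measure; rewrite ?inE; last by move=> w [].
  - by apply: measurableI; [exact: measurable_increments|exact: discrete_increments].
  - exact: discrete_increments.
case: (eqVneq (size s) n) => [sn|/eqP sn]; last first.
  rewrite (_ : mkset _ = set0) ?measure0//.
  by apply/seteqP; split => w //= e; apply: sn; rewrite -e size_increments.
rewrite prob_increments_eq//.
have [g gs mug] : exists2 g, g \in s & mu [set g] = 0%E.
  move/existsNP: hs => [g /not_implyP[gs /negP]]; rewrite -leNgt => mug.
  by exists g => //; apply/eqP; rewrite eq_le mug measure_ge0.
elim: (s) gs => // a u IH; rewrite inE big_cons => /orP[/eqP <-|/IH h].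
  by rewrite mug mul0e.
have -> : (\prod_(b <- u) mu [set b])%E = 0%E.
  by apply/eqP; rewrite eq_le h; apply: prode_ge0 => *; exact: measure_ge0.
by rewrite mule0.
Qed.

(** * Transience and escape from finite sets *)

Definition word_prod (s : seq L) : L := (\prod_(g <- s) g)%g.

Definition word_pos (s : seq L) : G := (word_prod s).2.

Lemma word_pos_cat s t : word_pos (s ++ t) = (word_pos s * word_pos t)%g.
Proof. by rewrite /word_pos /word_prod big_cat. Qed.

Lemma lamp_walkE n w : lamp_walk inc n w = word_prod (increments 0 n w).
Proof.
rewrite /lamp_walk /word_prod; elim: n => [|n IH] /=; first by rewrite big_nil.
by rewrite -addn1 increments_cat big_cat -IH /= big_seq1.
Qed.

Hypothesis trans : transient P (fun n w => (lamp_walk inc n w).2).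

Definition no_return (s : seq L) : Prop :=
  forall m, (0 < m <= size s)%N -> word_pos (take m s) <> 1%g.

Lemma prob_no_return : exists2 k : R, 0 < k & forall n,
  (k%:E <= P [set w | no_return (increments 0 n w)])%E.
Proof.
pose A := [set w | exists n, (lamp_walk inc n.+1 w).2 = (lamp_walk inc 0 w).2].
have mA : measurable A.
  have -> : A = \bigcup_n [set w | [set s | word_pos s = 1%g] (increments 0 n.+1 w)].
    apply/seteqP; split => w /=.
      by case=> n; rewrite lamp_walkE => h; exists n.
    by case=> n _ h; exists n; rewrite lamp_walkE.
  by apply: bigcupT_measurable => n; exact: measurable_increments.
have PA : P A \is a fin_num by exact: fin_num_measure.
exists (1 - fine (P A)); first by rewrite subr_gt0 -lte_fin fineK.
move=> n; rewrite EFinB fineK// -probability_setC//.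
apply: le_measure; rewrite ?inE; [exact: measurableC|exact: measurable_increments|].
move=> w Aw m /andP[m0]; rewrite size_increments => mn; rewrite take_increments// => e.
by apply: Aw; exists m.-1; rewrite prednK// lamp_walkE.
Qed.

(** Let k bound from below the probability of not returning.  For n < N, the
    events that b is visited at time n and not again in the next N steps are
    disjoint, and by independence each has probability at least k P(X_n = b),
    so these terms add up to at most 1/k. *)
Lemma green_bound : exists2 k : R, 0 < k & forall b N,
  (\sum_(n < N) P [set w | word_pos (increments 0 n w) = b] <= k%:E)%E.
Proof.
have [k k0 hk] := prob_no_return.
exists k^-1; first by rewrite invr_gt0.
move=> b N.
(* Beyond N these events need not be disjoint, so they are replaced by set0. *)
pose E n := if (n < N)%N then [set w | word_pos (increments 0 n w) = b] `&`
  [set w | no_return (increments n N w)] else set0.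
have mE n : measurable (E n).
  rewrite /E; case: ifP => _ //; apply: measurableI.
    exact: (measurable_increments 0 n [set s | word_pos s = b]).
  exact: measurable_increments.
have disj n m w : (n < m < N)%N -> E n w -> E m w -> False.
  move=> /andP[nm mN]; rewrite /E mN (ltn_trans nm mN) => -[en hn] [em _].
  apply: (hn (m - n)%N); first by rewrite size_increments; lia.
  rewrite take_increments; last lia.
  move: em => /=; rewrite -{1}(subnKC (ltnW nm)) increments_cat word_pos_cat add0n en.
  by move=> e; apply: (mulgI b); rewrite e mulg1.
have tE : trivIset setT E.
  apply/trivIsetP => i j _ _ ij; apply/seteqP; split => w //= [hi hj].
  have iN : (i < N)%N by move: hi; rewrite /E; case: ifP.
  have jN : (j < N)%N by move: hj; rewrite /E; case: ifP.
  move: ij; rewrite neq_ltn => /orP[ij|ji].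
    by apply: (disj i j w); rewrite ?ij.
  by apply: (disj j i w); rewrite ?ji.
have mU : measurable (\big[setU/set0]_(i < N) E i) by exact: bigsetU_measurable.
have := probability_le1 P mU.
rewrite measure_bigsetU// => h.
rewrite -(@lee_pmul2l _ k%:E)// -EFinM divff ?gt_eqF//.
rewrite ge0_sume_distrr//; apply: le_trans h; apply: lee_sum => n _.
have /= ind := increments_independent n N [set s | word_pos s = b] no_return.
rewrite /E ltn_ord ind.
by rewrite muleC lee_wpmul2l.
Qed.

Definition avoids (B : seq G) (x : G) (s : seq L) : Prop :=
  forall m, (m <= size s)%N -> (x * word_pos (take m s))%g \notin B.

(** By the bound on the Green function and the Borel-Cantelli lemma, the walk
    almost surely visits B finitely often.  So some finite word s of increments
    occurs, with positive probability, and is followed by no visit to B;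
    the position reached by s serves as starting point. *)
Lemma escape (B : seq G) : exists x, exists2 q : R, 0 < q &
  forall n, (q%:E <= P [set w | avoids B x (increments 0 n w)])%E.
Proof.
pose F n := [set w | word_pos (increments 0 n w) \in B].
have mF n : measurable (F n).
  exact: (measurable_increments 0 n [set s | word_pos s \in B]).
have [k k0 hk] := green_bound.
have sumF : (\sum_(0 <= n <oo) P (F n) < +oo)%E.
  apply: (@le_lt_trans _ _ ((size B)%:R * k)%:E); last by rewrite ltry.
  apply: lime_le; first by apply: is_cvg_nneseries => *; exact: measure_ge0.
  apply: nearW => N; rewrite big_mkord.
  apply: (@le_trans _ _ (\sum_(n < N) \sum_(b <- B)
      P [set w | word_pos (increments 0 n w) = b])%E).
    apply: lee_sum => n _; rewrite /F.
    elim: (B) => [|b B' IH].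
      by rewrite big_nil (_ : mkset _ = set0) ?measure0//; apply/seteqP; split.
    rewrite big_cons.
    have -> : [set w | word_pos (increments 0 n w) \in b :: B'] =
        [set w | word_pos (increments 0 n w) = b] `|`
        [set w | word_pos (increments 0 n w) \in B'].
      apply/seteqP; split => w /=; rewrite inE.
        by move=> /orP[/eqP|]; [left|right].
      by case=> [->|->]; rewrite ?eqxx ?orbT.
    have m1 := measurable_increments 0 n [set s | word_pos s = b].
    have m2 := measurable_increments 0 n [set s | word_pos s \in B'].
    apply: le_trans (measureU2 P m1 m2) _.
    by rewrite leeD2l.
  rewrite exchange_big /=.
  elim: (B) => [|b B' IH].
    by rewrite big_nil lee_fin mulr_ge0 ?ler0n ?ltW.
  rewrite big_cons /= -natr1 mulrDl mul1r [leRHS]EFinD [leRHS]addeC.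
  by apply: leeD; [exact: hk|exact: IH].
have limF0 := lim_sup_set_cvg0 mF sumF.
pose E (s : seq L) := [set w | increments 0 (size s) w = s] `&`
   \bigcap_n [set w | avoids B (word_pos s) (increments (size s) n w)].
have mE s : measurable (E s).
  apply: measurableI; first exact: discrete_increments.
  by apply: bigcapT_measurable => n; exact: measurable_increments.
have [s Es] : exists s, (0 < P (E s))%E.
  apply: contrapT => nE.
  have E0 s : P (E s) = 0%E.
    apply/eqP; rewrite eq_le measure_ge0 andbT leNgt; apply/negP => h.
    by apply: nE; exists s.
  suff /negligibleP : P.-negligible [set: Omega].
    move=> /(_ measurableT) h; have := probability_setT P.
    by rewrite h => /esym/eqP; rewrite onee_eq0.
  pose U j := [set w | exists2 s, word_code s = j & E s w].
  have nU j : P.-negligible (U j).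
    case: (pselect (exists s, word_code s = j)) => [[s sj]|ns].
      exists (E s); split => // w [t tj Et].
      by have -> : s = t by apply: word_code_inj; rewrite sj.
    exists set0; split => //.
    by move=> w [t tj _]; case: ns; exists t.
  have nF : P.-negligible (lim_sup_set F).
    exists (lim_sup_set F); split => //.
    by apply: bigcapT_measurable => j; apply: bigcup_measurable => *.
  apply: (negligibleS _ (negligibleU nF (negligible_bigcup nU))) => w _.
  case: (pselect (lim_sup_set F w)) => [|nl]; [by left|right].
  have [n hn] : exists n, forall m, (n <= m)%N -> ~ F m w.
    apply: contrapT => h; apply: nl => n _.
    apply: contrapT => h'; apply: h; exists n => m nm Fm.
    by apply: h'; exists m.
  exists (word_code (increments 0 n w)) => //.
  exists (increments 0 n w) => //; split; rewrite ?size_increments//.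
  move=> j _ m; rewrite size_increments => mj; rewrite take_increments//.
  by rewrite -word_pos_cat -increments_cat; apply/negP; apply: hn; rewrite leq_addr.
exists (word_pos s).
have fE : P (E s) \is a fin_num by exact: fin_num_measure.
exists (fine (P (E s))); first by rewrite -lte_fin fineK.
move=> n; rewrite fineK//.
apply: (@le_trans _ _ (P ([set w | increments 0 (size s) w = s] `&`
    [set w | avoids B (word_pos s) (increments (size s) n w)]))).
  apply: le_measure; rewrite ?inE//.
    by apply: measurableI; [exact: discrete_increments|exact: measurable_increments].
  by move=> w [h1 h2]; split => //; exact: h2.
rewrite (increments_independent (size s) n (eq^~ s)).
rewrite -[leRHS]mul1e lee_wpmul2r//.
by apply: probability_le1; exact: (discrete_increments 0 (size s)).
Qed.

(** * Lighting a finite set and leaving it forever *)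

Section filling.
Variables (F Q : seq G).
Hypothesis flips_in_Q :
  forall g, law_support mu g -> {subset finsupp g.1 <= Q}.
Hypothesis irr : irreducible_walk P inc.

Definition lit_around (x : G) (eta : config G) : Prop :=
  forall f, f \in F -> (x * f)%g \in finsupp eta.

Definition lamps_at (A : {fset G}) : config G := [fsfun w in A => 1 | 0].

(** The coordinates are relative to the position of the lamplighter. *)
Definition missing (g : L) : {fset G} := [fset f in F | g.1 (g.2 * f)%g == 0]%fset.

(** Right multiplication of g by this element switches on the missing lamps
    around the position of g and moves the lamplighter by x. *)
Definition patch (x : G) (g : L) : L := (lamps_at (missing g), x).

Lemma patch_lit x (g : L) : lit_around g.2 (g * patch x g)%g.1.
Proof.
move=> f fF; rewrite mem_finsupp /= config_addE config_shiftE mulKg fsfun_fun !inE fF /=.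
by case: ifP => [/eqP ->|/negbT h]; rewrite ?add0r ?addr0.
Qed.

Definition patches (x : G) : seq L :=
  [seq (lamps_at A, x) | A <- fpowerset [fset f in F]%fset].

Lemma patch_in_patches x (g : L) : patch x g \in patches x.
Proof.
apply/mapP; exists (missing g) => //; rewrite fpowersetE.
by apply/fsubsetP => f; rewrite !inE => /andP[].
Qed.

(** Irreducibility gives a time and a positive probability for each of the
    finitely many targets; the bounds are the maximum and the minimum of
    these. *)
Lemma uniform_reach (hs : seq L) : exists T : nat, exists2 p : R, 0 < p &
  forall h, h \in hs -> exists2 m, (m <= T)%N &
    (p%:E <= P [set w | word_prod (increments 0 m w) = h])%E.
Proof.
elim: hs => [|h hs [T [p p0 IH]]]; first by exists 0%N, 1.
have [m hm] := irr 1%g h.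
have e : [set w | walk_from inc 1%g m w = h] =
    [set w | word_prod (increments 0 m w) = h].
  by apply/seteqP; split => w /=; rewrite -[walk_from _ _ _ _]/(lamp_walk inc m w) lamp_walkE.
rewrite e in hm.
have fP : P [set w | word_prod (increments 0 m w) = h] \is a fin_num.
  by apply: fin_num_measure; exact: (measurable_increments 0 m [set s | word_prod s = h]).
exists (maxn T m), (Num.min p (fine (P [set w | word_prod (increments 0 m w) = h]))).
  by rewrite lt_min p0 -lte_fin fineK.
move=> h'; rewrite inE => /orP[/eqP ->|/IH[m' m'T hm']].
  exists m; first exact: leq_maxr.
  by rewrite -[leRHS]fineK// lee_fin ge_min lexx orbT.
exists m'; first by rewrite leq_max m'T.
by apply: le_trans hm'; rewrite lee_fin ge_min lexx.
Qed.

(** A step from relative position y can flip the lamp f only if y^-1 f is in Q,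
    that is, y = f q^-1 for some q in Q.  The identity is included so that
    leaving this set also excludes a return to the initial position. *)
Definition danger : seq G := 1%g :: [seq (f * q^-1)%g | f <- F, q <- Q].

(** After the past s, the future t realises the patch within T steps; from then
    on it stays out of the dangerous positions, and its increments are possible
    for mu, so that they flip lamps only at relative positions in Q. *)
Definition fills (x : G) (T : nat) (s t : seq L) : Prop :=
  exists m, [/\ (m <= T)%N, (m <= size t)%N,
    word_prod (take m t) = patch x (word_prod s),
    forall j, (m <= j <= size t)%N -> word_pos (take j t) \notin danger &
    {in drop m t, forall g, law_support mu g}].

(** The set of patches is finite, so the probability of the first part of
    [fills] is bounded below uniformly in the past; the second part is an
    independent escape from [danger]. *)
Lemma prob_fills : exists x T, exists2 a : R, 0 < a & forall i n, (T <= n)%N ->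
  (a%:E <= P [set w | fills x T (increments 0 i w) (increments i n w)])%E.
Proof.
have [x [q q0 hq]] := escape danger.
have [T [p p0 hp]] := uniform_reach (patches x).
exists x, T, (p * q); first exact: mulr_gt0.
move=> i n Tn.
apply: (@increments_markov i n (fills x T) (p * q)); first by rewrite mulr_ge0 ?ltW.
move=> s; have [m mT hm] := hp _ (patch_in_patches x (word_prod s)).
have mn : (m <= n)%N := leq_trans mT Tn.
pose h := patch x (word_prod s).
pose D (t : seq L) := avoids danger x t /\ {in t, forall g, law_support mu g}.
apply: (@le_trans _ _ (P ([set w | word_prod (increments 0 m w) = h] `&`
    [set w | D (increments m (n - m) w)]))).
  have /= -> := increments_independent m (n - m) [set u | word_prod u = h] D.
  rewrite EFinM; apply: lee_pmul; [by rewrite lee_fin ltW|by rewrite lee_fin ltW|exact: hm|].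
  exact: (le_trans (hq (n - m)%N) (prob_increments_support (n - m) (avoids danger x))).
apply: le_measure; rewrite ?inE.
- apply: measurableI; last exact: measurable_increments.
  exact: (measurable_increments 0 m [set u | word_prod u = h]).
- exact: measurable_increments.
move=> w /= [em [av sp]]; exists m; split => //.
- by rewrite size_increments.
- by rewrite take_increments.
- move=> j; rewrite size_increments => /andP[mj jn]; rewrite take_increments//.
  rewrite -(subnKC mj) increments_cat word_pos_cat add0n.
  have -> : word_pos (increments 0 m w) = x by rewrite /word_pos em.
  have := av (j - m)%N; rewrite size_increments take_increments; last lia.
  by apply; lia.
- by rewrite drop_increments.
Qed.

Lemma fills_far x T s t j : fills x T s t -> (T <= j <= size t)%N ->
  word_pos (take j t) <> 1%g.
Proof.
move=> [m [mT mt _ far _]] /andP[Tj jt] e.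
by have := far j; rewrite jt (leq_trans mT Tj) e mem_head => /(_ isT).
Qed.

(** The patch makes F lit around the initial position, and each later step
    leaves these lamps unchanged since a change would require a dangerous
    position. *)
Lemma fills_lit x T s t : fills x T s t ->
  lit_around (word_prod s).2 (word_prod (s ++ t)).1.
Proof.
move=> [m [_ mt em far sp]].
have prodD (u v : seq L) : word_prod (u ++ v) = (word_prod u * word_prod v)%g.
  by rewrite /word_prod big_cat.
suff main j : (m <= j <= size t)%N ->
    lit_around (word_prod s).2 (word_prod (s ++ take j t)).1.
  by have := main (size t); rewrite take_size; apply; rewrite mt leqnn.
elim: j => [|j IH].
  by rewrite leqn0 => /andP[/eqP m0 _]; move: em; rewrite m0 prodD => ->; exact: patch_lit.
move=> /andP[mj jt]; case: (ltngtP m j.+1) mj => // [mj|mj] _; last first.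
  by rewrite prodD -mj em; exact: patch_lit.
have {}IH : lit_around (word_prod s).2 (word_prod (s ++ take j t)).1.
  by apply: IH; rewrite -ltnS mj ltnW.
rewrite (take_nth 1%g)// -cats1 catA => f fF.
set a := nth _ _ _.
have la : law_support mu a.
  apply: sp; apply/(nthP 1%g); exists (j - m)%N.
    by rewrite size_drop ltn_sub2r// (leq_trans mj).
  by rewrite nth_drop subnKC.
rewrite prodD mem_finsupp [word_prod [:: a]]big_seq1 /= config_addE config_shiftE.
have -> : (word_prod (s ++ take j t)).2 =
    ((word_prod s).2 * word_pos (take j t))%g by rewrite prodD.
set y := word_pos _.
have -> : (((word_prod s).2 * y)^-1 * ((word_prod s).2 * f) = y^-1 * f)%g.
  by rewrite invgM -mulgA mulKg.
rewrite (@fsfun_dflt _ _ _ a.1); first by rewrite addr0 -mem_finsupp; exact: IH.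
apply/negP => /(flips_in_Q la) yQ.
have := far j; rewrite -ltnS mj ltnW// => /(_ isT) /negP; apply.
rewrite inE; apply/orP; right; apply/allpairsP; exists (f, y^-1 * f)%g; split => //=.
by rewrite invgM invgK mulVKg.
Qed.

Definition densely_lit (T K : nat) (a : R) : set Omega :=
  [set w | exists Y : seq G, [/\ uniq Y, a * K%:R <= (size Y)%:R &
     forall y, y \in Y -> lit_around y (lamp_walk inc (T * K) w).1]].

(** The attempts start at the multiples of T, where T exceeds the duration of a
    patch.  After a successful attempt its starting position is never visited
    again at a later multiple of T, so the successes have distinct centres. *)
Lemma many_lit : exists2 T : nat, (0 < T)%N & exists2 a : R, 0 < a &
  forall K, (0 < K)%N ->
  measurable (densely_lit T K a) /\ (a%:E <= P (densely_lit T K a))%E.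
Proof.
have [x [T0 [a a0 ha]]] := prob_fills.
pose T := T0.+1; exists T => //; exists (a / 2); first by rewrite divr_gt0.
move=> K K0.
pose E i := [set w | fills x T0 (increments 0 (T * i) w)
  (increments (T * i) (T * K - T * i) w)].
have mE i : measurable (E i).
  case: (leqP i K) => iK.
    have -> : E i = [set w | [set u | fills x T0 (take (T * i) u) (drop (T * i) u)]
      (increments 0 (T * K) w)].
      apply/seteqP; split => w; rewrite /E /= take_increments ?leq_mul2l ?iK ?orbT//;
      by rewrite drop_increments// leq_mul2l iK orbT.
    exact: measurable_increments.
  rewrite /E (_ : (T * K - T * i)%N = 0%N); last first.
    by apply/eqP; rewrite subn_eq0 leq_mul2l ltnW ?orbT.
  exact: (measurable_increments 0 (T * i) [set u | fills x T0 u [::]]).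
pose U := [set s : seq L | exists Y : seq G, [/\ uniq Y, a / 2 * K%:R <= (size Y)%:R &
     forall y, y \in Y -> lit_around y (word_prod s).1]].
have -> : densely_lit T K (a / 2) = [set w | U (increments 0 (T * K) w)].
  by apply/seteqP; split => w; rewrite /densely_lit /= lamp_walkE.
split; first exact: measurable_increments.
apply: (reverse_markov (K := K) (E := E)) => //.
- exact: ltW.
- exact: measurable_increments.
- by move=> i iK; apply: ha; rewrite -mulnBr ltnW// leq_pmulr// subn_gt0.
move=> w nU; rewrite leNgt; apply/negP => big; apply: nU.
pose I := [seq i <- iota 0 K | `[< E i w >]].
exists [seq word_pos (increments 0 (T * i) w) | i <- I]; split.
- rewrite map_inj_in_uniq ?filter_uniq ?iota_uniq// => i j.
  suff wlog i' j' : (i' < j')%N -> i' \in I -> j' \in I ->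
      word_pos (increments 0 (T * i') w) <> word_pos (increments 0 (T * j') w).
    move=> iI jI e; case: (ltngtP i j) => // h; first by case: (wlog _ _ h iI jI).
    by case: (wlog _ _ h jI iI).
  move=> ij; rewrite !mem_filter => /andP[/asboolP Ei _] /andP[_ ]; rewrite mem_iota.
  move=> /= jK e; apply: (fills_far Ei (j := (T * j' - T * i')%N)).
    rewrite size_increments -mulnBr; apply/andP; split.
      by rewrite ltnW// leq_pmulr// subn_gt0.
    by rewrite mulnBr leq_sub2r// leq_mul2l ltnW ?orbT.
  rewrite take_increments; last by rewrite leq_sub2r// leq_mul2l ltnW ?orbT.
  apply: (mulgI (word_pos (increments 0 (T * i') w))); rewrite mulg1 [RHS]e.
  rewrite -word_pos_cat; congr word_pos.
  by rewrite -increments_split// leq_mul2l ltnW ?orbT.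
- apply: le_trans (ltW big) _; rewrite size_map size_filter -(big_mkord xpredT (fun i => \1_(E i) w)).
  elim: (K) => [|k IH]; first by rewrite big_geq.
  rewrite big_nat_recr// -addn1 iotaD count_cat natrD lerD// indicE /= addn0.
  case: (boolP (w \in E k)) => [/set_mem/asboolP ->|//]; first by [].
- move=> y /mapP[i]; rewrite mem_filter mem_iota => /andP[/asboolP Ei /= iK] ->.
  have iK' : (T * i <= T * K)%N by rewrite leq_mul2l ltnW ?orbT.
  by rewrite (increments_split w iK'); exact: (fills_lit Ei).
Qed.

End filling.
End increments.

(** * Comparison of the limits *)

(** If b < a + e, then almost surely only finitely many of the E K occur, so the
    events H m that none occurs after m increase to an event of probability 1;
    but each H m has probability at most 1 - p. *)
Lemma limit_gap (R : realType) d (Omega : measurableType d)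
    (P : probability Omega R) (u v : nat -> Omega -> R) (a b e p : R)
    (T : nat) (E : nat -> set Omega) :
  as_limit P u a -> as_limit P v b -> (0 < T)%N -> 0 < p ->
  (forall K, (0 < K)%N -> measurable (E K) /\ (p%:E <= P (E K))%E) ->
  (forall K w, (0 < K)%N -> E K w -> e <= v (T * K)%N w - u (T * K)%N w) ->
  a + e <= b.
Proof.
move=> lu lv T0 p0 hE hgap; rewrite leNgt; apply/negP => ba.
pose H m := \bigcap_(K in [set K | (m <= K)%N]) ~` E K.+1.
have mH m : measurable (H m).
  apply: bigcap_measurable; first by exists m => /=.
  by move=> K _; apply: measurableC; exact: (hE K.+1 isT).1.
have mU : measurable (\bigcup_m H m) by exact: bigcupT_measurable.
have Hn : P (~` (\bigcup_m H m)) = 0%E.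
  apply: measure_negligible; first exact: measurableC.
  have : P.-negligible (~` [set w | u ^~ w @ \oo --> a /\ v ^~ w @ \oo --> b]).
    exact: (filterI lu lv).
  apply: negligibleS => w; apply: contra_not => -[uw vw].
  have : (fun n => v n w - u n w) @ \oo --> b - a by exact: cvgB.
  move=> /cvgr_lt/(_ e); rewrite ltrBlDl => /(_ ba)[N _ hN].
  exists N => // K /= NK EK.
  have := hgap _ w (ltn0Sn K) EK; rewrite leNgt hN//=.
  by rewrite (leq_trans (leqW NK))// leq_pmull.
have PU : P (\bigcup_m H m) = 1%E.
  by rewrite -[\bigcup_m H m]setCK probability_setC ?Hn ?sube0//; exact: measurableC.
have cH : P (H m) @[m --> \oo] --> P (\bigcup_m H m).
  apply: nondecreasing_cvg_mu => // m n mn; apply/subsetPset => w h K /= nK.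
  by apply: h => /=; exact: leq_trans nK.
have : (P (\bigcup_m H m) <= (1 - p)%:E)%E.
  rewrite -(cvg_lim _ cH)//; apply: lime_le; first by apply/cvg_ex; exists (P (\bigcup_m H m)).
  apply: nearW => m; have [mE pE] := hE m.+1 isT.
  apply: (@le_trans _ _ (P (~` E m.+1))).
    apply: le_measure; rewrite ?inE//; first exact: measurableC.
    by move=> w; apply => /=.
  rewrite probability_setC// EFinB; apply: leeB => //.
by rewrite PU lee_fin; lra.
Qed.

Theorem theorem4p4 (R : realType) (G : groupType) (S : set G) (l : G -> R)
  (c : R) (d : measure_display) (Omega : measurableType d)
  (P : probability Omega R) (mu : probability (lamplighter G) R)
  (inc : nat -> {mfun Omega >-> lamplighter G}) (ell0 ellTS ell : R) :
  infinite_set [set: G] ->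
  finite_set S -> symmetric_set S -> ~ S 1%g ->
  semigroup_generated S = [set: G] ->
  (forall s, S s -> 0 < l s /\ l (s^-1)%g = l s) ->
  (~ exists s s' : G, [/\ [set s; s'] `<=` S, symmetric_set [set s; s'] &
                          group_generated [set s; s'] = [set: G]]) ->
  0 <= c ->
  let Z := lamp_walk inc in
  let X := fun n w => (Z n w).2 in
  iid_with_law P inc mu ->
  irreducible_walk P inc ->
  transient P Z ->
  group_generated (law_support mu) = [set: lamplighter G] ->
  (exists2 r : R, 0 <= r & forall g : lamplighter G, law_support mu g ->
     {in finsupp g.1, forall y, word_dist S l 1%g y <= r}) ->
  (\esum_(g in [set: lamplighter G])
     ((word_dist S l 1%g g.2)%:E * mu [set g]) < +oo)%E ->
  transient P X ->
  as_limit P (fun n w => word_dist S l 1%g (X n w) / n%:R) ell0 ->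
  as_limit P (fun n w => dTS S l (Z n w) / n%:R) ellTS ->
  as_limit P (fun n w => lamp_length S l c (Z n w) / n%:R) ell ->
  ell0 < ellTS <= ell.
Proof.
move=> _ finS symS S1 genS lS no2 c0 Z X iid irr _ _ [r _ hr] _ transX lim0 limTS lim.
apply/andP; split; last first.
  rewrite -(addr0 ellTS).
  apply: (limit_gap limTS lim (T := 1) (p := 1) (E := fun _ => setT)) => //.
    by move=> K _; split => //; rewrite probability_setT.
  move=> K w _ _; rewrite subr_ge0 ler_wpM2r// lerDl mulr_ge0//.
have [code codeI] := lamplighter_countable finS genS.
have [Q hQ] := ball_finite finS genS lS r.
have /finite_seqP[e eS] := finS.
have flips g : law_support mu g -> {subset finsupp g.1 <= Q}.
  by move=> /hr hg y /hg/hQ.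
have [T T0 [a a0 ha]] := many_lit codeI iid transX (1%g :: e) flips irr.
have [c1 c10 hc1] := tour_detour finS symS S1 genS lS no2.
apply: (@lt_le_trans _ _ (ell0 + c1 * a / T%:R)).
  by rewrite ltrDl divr_gt0 ?mulr_gt0 ?ltr0n.
apply: (limit_gap lim0 limTS T0 a0 ha) => K w K0 [Y [uY sY litY]].
have := hc1 (Z (T * K)%N w) Y uY.
have hY y z : y \in Y -> (1%g |` S) z -> (y * z)%g \in finsupp (Z (T * K)%N w).1.
  move=> yY sz; apply: (litY _ yY); rewrite inE.
  by case: sz => [->|]; rewrite ?eqxx// eS /= => ->; rewrite orbT.
move=> /(_ hY) h.
have TK0 : 0 < (T * K)%:R :> R by rewrite ltr0n muln_gt0 T0.
rewrite -mulrBl ler_pdivlMr//.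
have -> : c1 * a / T%:R * (T * K)%:R = c1 * (a * K%:R).
  by rewrite natrM; field; rewrite pnatr_eq0 -lt0n.
rewrite lerBrDr; apply: le_trans h; rewrite lerD2r.
by rewrite ler_pM2l.
Qed.
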